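(* Let $G$ be a finitely presented group with a pseudocharacter $f\colon G\to\mathbb{R}$, let $E(f)$ be the set of ends of $G$ relative to $f$, and let $X$ be the graph constructed from $f$ (both described in the context). Then there is an injective map from $E(f)$ to the Gromov boundary $\partial X$.
   Context: **Pseudocharacters.** $f\colon G\to\mathbb{R}$ is a pseudocharacter if $f(\alpha^n)=nf(\alpha)$ for all $\alpha\in G$, $n\in\mathbb{Z}$, and $|f(\alpha)+f(\beta)-f(\alpha\beta)|$ is bounded over $\alpha,\beta\in G$; $\|\delta f\|$ denotes the least upper bound of this quantity. **The complex $\widetilde K$.** Choose a finite presentation $G=\langle S\mid R\rangle$ in which every word of $R$ has length three, with $S$ containing an element $s$ with $f(s)>\|\delta f\|$ (in particular $f\not\equiv0$). Let $\epsilon_{f,S}=\sup_{s\in S}|f(s)|+\|\delta f\|$. Scale $f$ by a positive real number so that $\epsilon_{f,S}<\frac14$ and $f(G)\cap(\mathbb{Z}+\frac12)=\emptyset$. Let $\Gamma(G,S)$ be the Cayley graph, and let $\widetilde K$ be the simply connected 2-complex obtained from $\Gamma(G,S)$ by equivariantly adding triangles for the relators (the universal cover of the presentation complex), with its left $G$-action; extend $f$ from $G=\widetilde K^0$ affinely over all edges and triangles to $f\colon\widetilde K\to\mathbb{R}$. **The set $E(f)$.** For a continuous $\phi\colon\mathbb{R}_+=[0,\infty)\to\Gamma(G,S)$ put $\sigma(\phi)=+1$ if $\lim_{t\to\infty}f(\phi(t))=\infty$, $\sigma(\phi)=-1$ if $\lim_{t\to\infty}f(\phi(t))=-\infty$,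 and $\sigma(\phi)=0$ otherwise. For $C>0$ write $\phi_1\sim_C\phi_2$ if $\sigma(\phi_1)=\sigma(\phi_2)$ and for every $D$ with $\sigma(\phi_1)D>C$ there is a path $\delta\colon[0,1]\to\Gamma(G,S)$ with $\delta(0)\in\phi_1(\mathbb{R}_+)$, $\delta(1)\in\phi_2(\mathbb{R}_+)$ and $|f(\delta(t))-D|\le C$ for all $t$. Write $\phi_1\sim\phi_2$ if $\phi_1\sim_C\phi_2$ for some $C$. $E(f)$ is the set of $\sim$-classes of continuous $\phi$ with $\sigma(\phi)\in\{+1,-1\}$. **The graph $X$.** Let $V$ be the set of connected components of $f^{-1}(\mathbb{Z}+\frac12)\subset\widetilde K$. $X$ is the simplicial graph with vertex set $G\times V$, where two distinct vertices $(g,\tau)$, $(g',\tau')$ are joined by an edge iff there are $h\in G$ and $n\in\mathbb{Z}$ such that $hg(\tau)$ and $hg'(\tau')$ are contained in the same connected component of $f^{-1}[n-\frac32,n+\frac12]$. $X$ has the path metric with edges of length one; it is quasi-isometric to a simplicial tree, hence Gromov hyperbolic. **Gromov boundary.** With a base point $m\in X$ and $(x.y)=\frac12(d(m,x)+d(m,y)-d(x,y))$, $\partial X$ is the set of sequences $\{x_i\}$ in $X$ with $\lim_{i,j\to\infty}(x_i.x_j)=\infty$, modulo $\{x_i\}\sim\{y_i\}$ iff $\lim_{i,j\to\infty}(x_i.y_j)=\infty$. *)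

(* Defs.v *)
From HB Require Import structures.
From mathcomp Require Import all_boot all_order all_algebra.
From mathcomp Require Import all_classical all_reals all_analysis.

Set Implicit Arguments.
Unset Strict Implicit.
Unset Printing Implicit Defensive.

Import Order.TTheory GRing.Theory Num.Theory.
Import numFieldNormedType.Exports.
Local Open Scope classical_set_scope.
Local Open Scope ring_scope.

(** * Pseudocharacters *)

Definition expgz (G : groupType) (x : G) (n : int) : G :=
  match n with Posz k => (x ^+ k)%g | Negz k => (x ^- k.+1)%g end.

Definition defect_set (R : realType) (G : groupType) (f : G -> R) : set R :=
  [set `|f ab.1 + f ab.2 - f (ab.1 * ab.2)%g| | ab in [set: G * G]].

Definition defect (R : realType) (G : groupType) (f : G -> R) : R :=
  sup (defect_set f).

Definition pseudocharacter (R : realType) (G : groupType) (f : G -> R) : Prop :=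
  (forall (a : G) (n : int), f (expgz a n) = n%:~R * f a) /\
  has_ubound (defect_set f).

(** * Finite presentations with relators of length three *)

(* The letter [(s, true)] stands for [s], and [(s, false)] for its inverse. *)
Definition letter_val (G : groupType) (S : Type) (gen : S -> G)
    (l : S * bool) : G :=
  if l.2 then gen l.1 else ((gen l.1)^-1)%g.

Definition word_val (G : groupType) (S : Type) (gen : S -> G)
    (w : seq (S * bool)) : G :=
  (\prod_(l <- w) letter_val gen l)%g.

(* [word_eq rels w w'] : [w] and [w'] represent the same element of the
   abstract group presented by the generators [S] and the relators [rels]. *)
Inductive word_eq (S : finType) (rels : {set 3.-tuple (S * bool)}) :
    seq (S * bool) -> seq (S * bool) -> Prop :=
| word_eq_refl w : word_eq rels w w
| word_eq_sym w w' : word_eq rels w w' -> word_eq rels w' w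
| word_eq_trans w1 w2 w3 :
    word_eq rels w1 w2 -> word_eq rels w2 w3 -> word_eq rels w1 w3
| word_eq_cancel u v s b :
    word_eq rels (u ++ [:: (s, b); (s, ~~ b)] ++ v) (u ++ v)
| word_eq_relator u v (r : 3.-tuple (S * bool)) :
    r \in rels -> word_eq rels (u ++ r ++ v) (u ++ v).

Record tri_presentation (G : groupType) := TriPresentation {
  generators : finType;
  gen : generators -> G;
  relators : {set 3.-tuple (generators * bool)};
  gen_surj : forall g : G, exists w, word_val gen w = g;
  presentsP : forall w w', word_eq relators w w' <-> word_val gen w = word_val gen w'
}.

Definition epsilon (R : realType) (G : groupType) (P : tri_presentation G)
    (f : G -> R) : R :=
  sup [set `|f (gen s)| | s in [set: generators P]] + defect f.

(** * The complex K~ *)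

(* The universal cover of the presentation complex, as the disjoint union of
   its open cells: the vertices are the elements of G, there is one edge from
   [g] to [g * gen s] for each [(g, s)], and one triangle based at [g] for each
   pair of [g] and a relator. The point [p] of a triangle has barycentric
   coordinates [(1 - p.1 - p.2, p.1, p.2)]. *)
Inductive cover_complex (R : realType) (G : groupType)
    (P : tri_presentation G) : Type :=
| Vertex of G
| OpenEdge of G & generators P & {t : R | 0 < t < 1}
| OpenTriangle of G & {r | r \in relators P}
    & {p : R * R | [&& 0 < p.1, 0 < p.2 & p.1 + p.2 < 1]}.

Arguments Vertex {R G P} _.
Arguments OpenEdge {R G P} _ _ _.
Arguments OpenTriangle {R G P} _ _ _.

HB.instance Definition _ (R : realType) (G : groupType)
  (P : tri_presentation G) := gen_eqMixin (cover_complex R P).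
HB.instance Definition _ (R : realType) (G : groupType)
  (P : tri_presentation G) := gen_choiceMixin (cover_complex R P).

Section complex.
Variables (R : realType) (G : groupType) (P : tri_presentation G).
Notation K := (cover_complex R P).
Notation letter := (generators P * bool)%type.

(* Characteristic map [0, 1] -> K of the edge from [g] to [g * gen s]. *)
Definition edge_map (g : G) (s : generators P) (t : R) : K :=
  if insub t : option {t : R | 0 < t < 1} is Some u then OpenEdge g s u
  else if t <= 0 then Vertex g else Vertex (g * gen s)%g.

(* The edge path of length one read from [g] along the letter [l]; an inverse
   letter traverses an edge backwards. *)
Definition letter_map (g : G) (l : letter) (t : R) : K :=
  if l.2 then edge_map g l.1 t
  else edge_map (g * (gen l.1)^-1)%g l.1 (1 - t).

Definition triangle : set (R * R) :=
  [set p | [/\ 0 <= p.1, 0 <= p.2 & p.1 + p.2 <= 1]].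

(* The three corners of the triangle of a relator [l0 l1 l2] based at [g]. *)
Definition corner (g : G) (r : 3.-tuple letter) (i : nat) : G :=
  (g * word_val (@gen G P) (take i r))%g.

(* Characteristic map triangle -> K; the sides are attached along the edge
   loop spelled by the relator. *)
Definition triangle_map (g : G) (r : {r | r \in relators P}) (p : R * R) : K :=
  let a i := corner g (val r) i in
  let l (i : 'I_3) := tnth (val r) i in
  if insub p : option {p : R * R | [&& 0 < p.1, 0 < p.2 & p.1 + p.2 < 1]}
    is Some q then OpenTriangle g r q
  else if p.2 == 0 then letter_map (a 0%N) (l ord0) p.1
  else if p.1 == 0 then letter_map (a 2%N) (l ord_max) (1 - p.2)
  else letter_map (a 1%N) (l (inord 1)) p.2.

(* The CW (weak) topology. *)
Definition open_complex : set_system K := [set U |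
  (forall g s, open (edge_map g s @^-1` U : set (subspace `[0, 1]))) /\
  (forall g r, open (triangle_map g r @^-1` U : set (subspace triangle)))].

Lemma open_complexT : open_complex setT.
Proof. by split=> *; rewrite preimage_setT; exact: openT. Qed.

Lemma open_complexI : setI_closed open_complex.
Proof.
move=> U V [Ue Ut] [Ve Vt]; split=> g x; rewrite preimage_setI.
- exact: openI (Ue g x) (Ve g x).
- exact: openI (Ut g x) (Vt g x).
Qed.

Lemma open_complex_bigU (I : Type) (F : I -> set K) :
  (forall i, open_complex (F i)) -> open_complex (\bigcup_i F i).
Proof.
move=> oF; split=> g x; rewrite preimage_bigcup; apply: bigcup_open => i _.
- by have [+ _] := oF i; apply.
- by have [_ +] := oF i; apply.
Qed.

HB.instance Definition _ := isOpenTopological.Build K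
  open_complexT open_complexI open_complex_bigU.

Definition cayley_graph : set K :=
  [set x | if x is OpenTriangle _ _ _ then False else True].

Definition translate (h : G) (x : K) : K :=
  match x with
  | Vertex g => Vertex (h * g)%g
  | OpenEdge g s t => OpenEdge (h * g)%g s t
  | OpenTriangle g r p => OpenTriangle (h * g)%g r p
  end.

Variable f : G -> R.

Definition extend (x : K) : R :=
  match x with
  | Vertex g => f g
  | OpenEdge g s t => (1 - val t) * f g + val t * f (g * gen s)%g
  | OpenTriangle g r p =>
      (1 - (val p).1 - (val p).2) * f (corner g (val r) 0%N)
      + (val p).1 * f (corner g (val r) 1%N)
      + (val p).2 * f (corner g (val r) 2%N)
  end.

(** * The set E(f) *)

(* A continuous map from [0, +oo) to the Cayley graph; its values on negative
   numbers are irrelevant. *)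
Record ray := Ray {
  ray_fun :> R -> K;
  ray_continuous : {within `[0, +oo[, continuous ray_fun};
  ray_graph : forall t, 0 <= t -> cayley_graph (ray_fun t)
}.

Definition ray_sign (phi : ray) : R :=
  if `[< extend (phi t) @[t --> +oo] --> +oo >] then 1
  else if `[< extend (phi t) @[t --> +oo] --> -oo >] then -1
  else 0.

Definition ray_image (phi : ray) : set K := phi @` `[0, +oo[.

Definition ray_equiv_at (C : R) (phi1 phi2 : ray) : Prop :=
  ray_sign phi1 = ray_sign phi2 /\
  forall D : R, C < ray_sign phi1 * D ->
    exists delta : R -> K,
      [/\ {within `[0, 1], continuous delta},
          forall t, 0 <= t <= 1 -> cayley_graph (delta t),
          ray_image phi1 (delta 0),
          ray_image phi2 (delta 1)
        & forall t, 0 <= t <= 1 -> `|extend (delta t) - D| <= C].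

Definition ray_equiv (phi1 phi2 : ray) : Prop :=
  exists2 C, 0 < C & ray_equiv_at C phi1 phi2.

Definition relative_ends : set (set ray) :=
  [set [set psi | ray_equiv phi psi]
    | phi in [set phi | ray_sign phi = 1 \/ ray_sign phi = -1]].

(** * The vertices and edges of the graph X *)

Definition half_integer_levels : set K :=
  [set x | exists n : int, extend x = n%:~R + 2^-1].

Definition tracks : set (set K) :=
  [set connected_component half_integer_levels x | x in half_integer_levels].

Definition slab (n : int) : set K :=
  [set x | n%:~R - 3 / 2 <= extend x <= n%:~R + 2^-1].

Definition X_vertex := (G * set_type tracks)%type.

Definition X_adj (v w : X_vertex) : Prop :=
  v <> w /\
  exists (h : G) (n : int), exists2 x, slab n x &
    translate (h * v.1)%g @` val v.2 `<=` connected_component (slab n) x /\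
    translate (h * w.1)%g @` val w.2 `<=` connected_component (slab n) x.

End complex.

(** * Metric graphs *)

Section metric_graph.
Variables (R : realType) (T : Type) (adj : T -> T -> Prop).

(* The point at parameter [t] of the segment from [v] to [w], given by its
   barycentric coordinates. *)
Definition segment_point (v w : T) (t : R) : T -> R :=
  fun u => (1 - t) * \1_[set v] u + t * \1_[set w] u.

(* The geometric realization; the case [v = w] accounts for the vertices. *)
Record graph_point := GraphPoint {
  bary :> T -> R;
  baryP : exists v w t,
    [/\ v = w \/ adj v w, 0 <= t <= 1 & bary = segment_point v w t]
}.

(* [chain_length x y l] : some piecewise linear path from [x] to [y] has
   length [l], edges having length one. *)
Inductive chain_length : graph_point -> graph_point -> R -> Prop :=
| chain_nil x : chain_length x x 0
| chain_cons x y z v w s t l :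
    adj v w -> 0 <= s <= 1 -> 0 <= t <= 1 ->
    bary x = segment_point v w s -> bary y = segment_point v w t ->
    chain_length y z l -> chain_length x z (`|s - t| + l).

Definition path_dist (x y : graph_point) : R := inf [set l | chain_length x y l].

End metric_graph.

(** * Gromov boundary *)

Section gromov_boundary.
Variables (R : realType) (X : Type) (d : X -> X -> R) (m : X).

Definition gromov_product (x y : X) : R := (d m x + d m y - d x y) / 2.

Definition product_diverges (x y : nat -> X) : Prop :=
  gromov_product (x ij.1) (y ij.2) @[ij --> filter_prod \oo \oo] --> +oo.

Definition gromov_boundary : set (set (nat -> X)) :=
  [set [set y | product_diverges y y /\ product_diverges x y]
    | x in [set x | product_diverges x x]].

End gromov_boundary.

(** * The space X *)

Definition X_space (R : realType) (G : groupType) (P : tri_presentation G)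
    (f : G -> R) : Type :=
  graph_point R (@X_adj R G P f).

Definition X_dist (R : realType) (G : groupType) (P : tri_presentation G)
    (f : G -> R) : X_space P f -> X_space P f -> R :=
  @path_dist R (X_vertex P f) (@X_adj R G P f).

(* Main.v *)
Require Import Defs.
From mathcomp Require Import all_boot all_order all_algebra.
From mathcomp Require Import all_classical all_reals all_analysis.
From mathcomp Require Import zify ring lra.
Import Order.TTheory GRing.Theory Num.Theory.
Import numFieldNormedType.Exports.
Local Open Scope classical_set_scope.
Local Open Scope ring_scope.

(** Below [f] stands for the scaled pseudocharacter, extended to the complex
    [K]. A track is a component of a level [f = n + 1/2].

    The heart of the matter is that every track [T] separates [K]. Count
    modulo 2 the crossings of [T] by an edge path: a triangle is crossed twice
    or not at all, so the count depends only on the ends of the path, because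
    the relators present the group. Giving [|f - (n + 1/2)|] the sign of this
    count produces a function [a] on the group whose affine extension vanishes
    only on [T] ([height_zero]); the sign of [a] tells the sides of [T]. A path
    from below a level to above it crosses the level an odd number of times,
    hence some track of this level separates its ends ([separating_track]).

    Tracks are bottlenecks of [X]. An edge of [X] comes with a connected set of
    bounded [f]-width containing the two translated tracks. Along a walk from
    one side of [T] to the other these sets form a connected chain, so one of
    them meets [T], and then the walk passes within 2 of the vertex [(1, T)]
    ([near_track], [walk_bottleneck]). Moreover [f] changes by at most 3 along
    an edge of [X] ([walk_level]), and [X] is connected because some generator
    makes [f] increase at every vertex ([climb], [X_connected]).

    Now let [phi] be a ray along which [f] tends to plus or minus infinity. For
    every [k] some track [T_k] of level [k + 1/2], respectively [- (k + 1/2)],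
    separates the vertex [1] from the tail of [phi]. Put [x_k = (1, T_k)]. For
    [k] large, [T_k] separates the base point from [T_i] and [T_j] as soon as
    [i] and [j] are large in terms of [k]. The bottleneck property then gives
    [(x_i . x_j) >= d(m, x_k) - O(1)], which tends to infinity with [k]
    ([crossing_seq_diverges]). The class of [phi] is sent
    to the boundary point of [(x_k)].

    If some track [T] separates the tails of [phi] and [psi], the same property
    bounds [(x_i . y_j)] by [d(m, (1, T)) + O(1)], and the boundary points
    differ ([diverges_same_tails]). If no track does, then for every large level
    a track separating [1] from the tail of [phi] is crossed by both rays, and a
    path from one to the other follows it at almost constant height
    ([same_tails_close]). Conversely, equivalent rays have their tails on the
    same side of every track ([close_same_tails]). So lying on the same side of
    every track is an equivalence relation on rays that mediates between the
    definition of [E(f)] and the equality of boundary points. *)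

Set Implicit Arguments.
Unset Strict Implicit.
Unset Printing Implicit Defensive.

(** * The characteristic maps and affine functions *)

Lemma within_comp (T U V : topologicalType) (A : set T) (B : set U)
    (f : T -> U) (g : U -> V) :
  {within A, continuous f} -> f @` A `<=` B -> {within B, continuous g} ->
  {within A, continuous (g \o f)}.
Proof.
move=> /subspace_continuousP cf fAB /subspace_continuousP cg.
apply/subspace_continuousP => x Ax.
have Bfx : B (f x) by apply: fAB; exists x.
move=> W /(cg _ Bfx) nW.
have := cf _ Ax _ nW; rewrite /nbhs /= /within /= => nfW.
rewrite /fmap /=; near=> y => Ay.
have := near nfW y; apply => //; by apply: fAB; exists y.
Unshelve. all: by end_near. Qed.

Lemma continuous_within_comp (T U V : topologicalType) (A : set T)
    (f : T -> U) (g : U -> V) :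
  {within A, continuous f} -> continuous g -> {within A, continuous (g \o f)}.
Proof.
move=> cf cg; apply: within_continuous_comp => // x _; exact: cg.
Qed.

Section cells.
Variables (R : realType) (G : groupType) (P : tri_presentation G).
Notation K := (cover_complex R P).
Notation letter := (generators P * bool)%type.
Implicit Types (b : G -> R) (g h v : G) (x y : K).

Notation lval := (letter_val (@gen G P)).

Lemma edge_map_continuous g s :
  {within `[0, 1], continuous (@edge_map R G P g s)}.
Proof. by apply/continuousP => U [oU _]; exact: oU. Qed.

Lemma triangle_map_continuous g r :
  {within @triangle R, continuous (@triangle_map R G P g r)}.
Proof. by apply/continuousP => U [_ oU]; exact: oU. Qed.

Lemma extend_edge b g s t : 0 <= t <= 1 ->
  extend b (@edge_map R G P g s t) = (1 - t) * b g + t * b (g * gen s)%g.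
Proof.
move=> /andP[t0 t1]; rewrite /edge_map; case: insubP => [u _ /= -> //|].
rewrite negb_and -!leNgt => /orP[tle|tge].
  have -> : t = 0 by apply/eqP; rewrite eq_le tle t0.
  by rewrite lexx /= subr0 mul1r mul0r addr0.
have -> : t = 1 by apply/eqP; rewrite eq_le tge t1.
by rewrite ler10 /= subrr mul1r mul0r add0r.
Qed.

Lemma extend_letter b g l t : 0 <= t <= 1 ->
  extend b (@letter_map R G P g l t) = (1 - t) * b g + t * b (g * lval l)%g.
Proof.
move=> t01; case: l => s [] /=; rewrite /letter_map /letter_val /= extend_edge//.
  by rewrite mulgVK; ring.
by move: t01 => /andP[? ?]; apply/andP; split; lra.
Qed.

Lemma relator_val (r : {r | r \in relators P}) : word_val (@gen G P) (val r) = 1%g.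
Proof.
have /presentsP : word_eq (relators P) ([::] ++ val r ++ [::]) ([::] ++ [::]).
  exact: word_eq_relator (valP r).
by rewrite /= cats0 => ->; rewrite /word_val big_nil.
Qed.

Lemma corner0 g (r : 3.-tuple letter) : corner g r 0 = g.
Proof. by rewrite /corner take0 /word_val big_nil mulg1. Qed.

Lemma cornerS g (r : 3.-tuple letter) (i : 'I_3) :
  corner g r i.+1 = (corner g r i * lval (tnth r i))%g.
Proof.
rewrite /corner (take_nth (tnth r i)) ?size_tuple// -tnth_nth.
by rewrite /word_val -cats1 big_cat big_seq1 mulgA.
Qed.

Lemma corner3 g (r : {r | r \in relators P}) : corner g (val r) 3 = g.
Proof. by rewrite /corner take_oversize ?size_tuple// relator_val mulg1. Qed.

Lemma extend_triangle b g (r : {r | r \in relators P}) p : @triangle R p ->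
  extend b (triangle_map g r p) = (1 - p.1 - p.2) * b (corner g (val r) 0)
   + p.1 * b (corner g (val r) 1) + p.2 * b (corner g (val r) 2).
Proof.
move=> [p1 p2 p12].
have I1 : 0 <= p.1 <= 1 by lra.
have I2 : 0 <= p.2 <= 1 by lra.
have I3 : 0 <= 1 - p.2 <= 1 by lra.
rewrite /triangle_map; case: insubP => [q _ /= -> //|].
have E0 := cornerS g (val r) ord0; have E1 := cornerS g (val r) (inord 1).
have E2 := cornerS g (val r) ord_max.
rewrite inordK// in E1.
case: eqP => [-> _|/eqP p2n].
  by rewrite extend_letter// -E0; ring.
case: eqP => [-> _|/eqP p1n].
  by rewrite extend_letter// -E2 corner3 corner0; ring.
rewrite !lt_neqAle p1 p2 eq_sym p1n eq_sym p2n p12 /= andbT negbK => /eqP e.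
by rewrite extend_letter// -E1 -e; ring.
Qed.

(** In the coordinates of a closed cell the extension is affine, also at the
    points which the characteristic map sends to faces of the cell. *)
Lemma extend_continuous b : continuous (extend b : K -> R).
Proof.
have ce g s : {within `[0, 1], continuous (extend b \o @edge_map R G P g s)}.
  have E : {in `[(0:R), 1], (fun t => (1 - t) * b g + t * b (g * gen s)%g)
      =1 extend b \o @edge_map R G P g s}.
    by move=> t; rewrite in_itv /= => t01; rewrite extend_edge.
  apply: (subspace_eq_continuous (f := fun t : subspace `[(0:R), 1] => (1 - t) * b g + t * b (g * gen s)%g)).
    by move=> t; rewrite inE /= => /E.
  apply: continuous_subspaceT => t.
  by apply: cvgD; apply: cvgMr_tmp; [apply: cvgB; [exact: cvg_cst|exact: cvg_id]|exact: cvg_id].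
have ct g (r : {r | r \in relators P}) :
    {within @triangle R, continuous (extend b \o triangle_map g r)}.
  apply: (subspace_eq_continuous (f := fun p : subspace (@triangle R) =>
    (1 - p.1 - p.2) * b (corner g (val r) 0)
   + p.1 * b (corner g (val r) 1) + p.2 * b (corner g (val r) 2))).
    by move=> p; rewrite inE => pT; exact/esym/extend_triangle.
  apply: continuous_subspaceT => p.
  have c1 : (@fst R R) q @[q --> p] --> p.1 by exact: cvg_fst.
  have c2 : (@snd R R) q @[q --> p] --> p.2 by exact: cvg_snd.
  apply: cvgD; [apply: cvgD|]; apply: cvgMr_tmp => //.
  by apply: cvgB => //; apply: cvgB => //; exact: cvg_cst.
apply/continuousP => U oU; split=> g x; rewrite -comp_preimage.
- by have /continuousP := ce g x; apply.
- by have /continuousP := ct g x; apply.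
Qed.

End cells.
(** * Closed cells *)

(** Outside [A] the topology of [subspace A] is discrete, so that part of [W]
    is harmless. *)
Lemma closed_subspaceI (T : topologicalType) (A W : set T) :
  closed (A `&` W : set (subspace A)) -> closed (W : set (subspace A)).
Proof.
move=> cAW; rewrite (_ : W = (A `&` W) `|` (W `&` ~` A)); last first.
  by rewrite [X in X `|` _]setIC -setIUr setUCr setIT.
apply: closedU => //; rewrite -openC -open_subspaceIT setCI setCK setIUl setIid.
rewrite (_ : _ `|` _ = A); first exact: open_subspaceT.
by apply/seteqP; split=> x; [case=> // -[]|right].
Qed.

Lemma le_conv2 (R : realDomainType) (u x y m : R) : 0 < u -> u < 1 ->
  m <= x -> m <= y -> m <= (1 - u) * x + u * y.
Proof.
move=> u0 u1 mx my.
have -> : (1 - u) * x + u * y = m + (1 - u) * (x - m) + u * (y - m) by ring.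
by rewrite -addrA lerDl addr_ge0// mulr_ge0//; lra.
Qed.

Lemma le_conv3 (R : realDomainType) (u w x y z m : R) :
  0 < u -> 0 < w -> u + w < 1 -> m <= x -> m <= y -> m <= z ->
  m <= (1 - u - w) * x + u * y + w * z.
Proof.
move=> u0 u1 uw mx my mz.
have -> : (1 - u - w) * x + u * y + w * z =
   m + ((1 - u - w) * (x - m) + u * (y - m) + w * (z - m)) by ring.
by rewrite lerDl !addr_ge0// mulr_ge0//; lra.
Qed.

Lemma conv_continuous (R : realType) (u w : R) :
  continuous (fun t : R => (1 - t) * u + t * w).
Proof.
move=> t; apply: cvgD; apply: cvgMr_tmp; last exact: cvg_id.
by apply: cvgB; [exact: cvg_cst|exact: cvg_id].
Qed.

Section closed_cells.
Variables (R : realType) (G : groupType) (P : tri_presentation G).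
Notation K := (cover_complex R P).
Notation letter := (generators P * bool)%type.
Implicit Types (b : G -> R) (g h v : G) (x y : K).

Notation lval := (letter_val (@gen G P)).

(** Vertices get no closed cells of their own: they are ends of edges as soon as
    there is a generator. *)
Definition cell : Type :=
  ((G * generators P) + (G * {r | r \in relators P}))%type.

Definition cell_set (c : cell) : set K :=
  match c with
  | inl e => @edge_map R G P e.1 e.2 @` `[0, 1]
  | inr e => triangle_map e.1 e.2 @` @triangle R
  end.

Definition cell_vertices (c : cell) : set G :=
  match c with
  | inl e => [set e.1; (e.1 * gen e.2)%g]
  | inr e => [set corner e.1 (val e.2) 0; corner e.1 (val e.2) 1;
      corner e.1 (val e.2) 2]
  end.

(** The vertices of the open cell that contains a point. *)
Definition carrier (x : K) : set G :=
  match x with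
  | Vertex g => [set g]
  | OpenEdge g s _ => [set g; (g * gen s)%g]
  | OpenTriangle g r _ => [set corner g (val r) 0; corner g (val r) 1;
      corner g (val r) 2]
  end.

Lemma corner_steps g (r : {r | r \in relators P}) :
  [/\ corner g (val r) 1 = (corner g (val r) 0 * lval (tnth (val r) ord0))%g,
      corner g (val r) 2 = (corner g (val r) 1 * lval (tnth (val r) (inord 1)))%g
    & corner g (val r) 0 = (corner g (val r) 2 * lval (tnth (val r) ord_max))%g].
Proof.
have E1 := cornerS g (val r) (inord 1); rewrite inordK// in E1.
split=> //; first exact: (cornerS g (val r) ord0).
by rewrite corner0 -[LHS](corner3 g r); exact: (cornerS g (val r) ord_max).
Qed.

Lemma edge_map0 g s : @edge_map R G P g s 0 = Vertex g.
Proof.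
by rewrite /edge_map lexx insubF// ltxx.
Qed.

Lemma edge_map1 g s : @edge_map R G P g s 1 = Vertex (g * gen s)%g.
Proof.
by rewrite /edge_map ler10 insubF// ltxx andbF.
Qed.

Lemma letter_map0 g l : @letter_map R G P g l 0 = Vertex g.
Proof.
by case: l => s [] /=; rewrite /letter_map /= ?subr0 ?edge_map0 ?edge_map1 ?mulgVK.
Qed.

Lemma letter_map1 g l : @letter_map R G P g l 1 = Vertex (g * lval l)%g.
Proof.
by case: l => s [] /=; rewrite /letter_map /letter_val /= ?subrr ?edge_map0 ?edge_map1.
Qed.

Lemma carrier_edge g s t : carrier (@edge_map R G P g s t) `<=` [set g; (g * gen s)%g].
Proof.
rewrite /edge_map; case: insub => [u|] //=.
by case: ifP => _ v /= ->; [left|right].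
Qed.

Lemma carrier_letter g l t :
  carrier (@letter_map R G P g l t) `<=` [set g; (g * lval l)%g].
Proof.
case: l => s []; rewrite /letter_map /letter_val /=; first exact: carrier_edge.
move=> v /carrier_edge[]->; first by right.
by left => /=; rewrite mulgVK.
Qed.

Lemma carrier_triangle g (r : {r | r \in relators P}) (p : R * R) :
  carrier (triangle_map g r p) `<=` [set corner g (val r) 0; corner g (val r) 1;
      corner g (val r) 2].
Proof.
have [E0 E1 E2] := corner_steps g r.
rewrite /triangle_map; case: insub => [q //=|].
case: eqP => [_|_] v.
  by move=> /carrier_letter[]->; left; [left|right; exact: esym E0].
case: eqP v => [_|_] v.
  by move=> /carrier_letter[]->; [right|left; left; exact: esym E2].
by move=> /carrier_letter[]->; [left; right|right; exact: esym E1].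
Qed.

Lemma cell_carrier c x : cell_set c x -> carrier x `<=` cell_vertices c.
Proof.
case: c => [[g s]|[g r]] /= [t _ <-]; first exact: carrier_edge.
exact: carrier_triangle.
Qed.

Lemma cell_vertex c v : cell_vertices c v -> cell_set c (Vertex v).
Proof.
case: c => [[g s]|[g r]] /=.
  case=> ->; [exists 0; rewrite ?edge_map0//|exists 1; rewrite ?edge_map1//];
  by rewrite /= in_itv /= lexx ler01.
have T0 : @triangle R (0, 0) by split => /=; lra.
have T1 : @triangle R (1, 0) by split => /=; lra.
have T2 : @triangle R (0, 1) by split => /=; lra.
have [E0 E1 E2] := corner_steps g r.
case=> [[]|] ->.
- exists (0, 0) => //.
  by rewrite /triangle_map insubF ?ltxx//= eqxx letter_map0.
- exists (1, 0) => //.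
  by rewrite /triangle_map insubF ?ltxx ?andbF//= eqxx letter_map1 -E0.
- exists (0, 1) => //.
  by rewrite /triangle_map insubF ?ltxx//= oner_eq0 eqxx subrr letter_map0.
Qed.

Lemma translate_edge h g s t :
  translate h (@edge_map R G P g s t) = edge_map (h * g)%g s t.
Proof.
by rewrite /edge_map; case: insub => //=; case: ifP => //=; rewrite mulgA.
Qed.

Lemma translate_letter h g l t :
  translate h (@letter_map R G P g l t) = letter_map (h * g)%g l t.
Proof. by rewrite /letter_map; case: ifP; rewrite translate_edge ?mulgA. Qed.

Lemma corner_translate h g (r : 3.-tuple letter) i :
  corner (h * g)%g r i = (h * corner g r i)%g.
Proof. by rewrite /corner mulgA. Qed.

Lemma translate_triangle h g (r : {r | r \in relators P}) (p : R * R) :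
  translate h (triangle_map g r p) = triangle_map (h * g)%g r p.
Proof.
rewrite /triangle_map; case: insub => //=.
by case: ifP => _; [|case: ifP => _]; rewrite translate_letter corner_translate.
Qed.

Lemma translate_continuous h : continuous (translate h : K -> K).
Proof.
apply/continuousP => U [Ue Ut]; split=> g x; rewrite -comp_preimage.
- rewrite (_ : _ \o _ = edge_map (h * g)%g x); first exact: Ue.
  by apply/funext => t /=; rewrite translate_edge.
- rewrite (_ : _ \o _ = triangle_map (h * g)%g x); first exact: Ut.
  by apply/funext => t /=; rewrite translate_triangle.
Qed.

Lemma extend_translate b h x :
  extend b (translate h x) = extend (fun g => b (h * g)%g) x.
Proof. by case: x => [g|g s t|g r p] //=; rewrite ?mulgA// !corner_translate. Qed.

Lemma translateM h h' x : translate h (translate h' x) = translate (h * h')%g x.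
Proof. by case: x => [g|g s t|g r p] //=; rewrite ?mulgA. Qed.

Lemma translate1 x : translate 1%g x = x.
Proof. by case: x => [g|g s t|g r p] //=; rewrite ?mul1g. Qed.

(** A generator is required only for the sake of the vertices. *)
Lemma cell_cover (s0 : generators P) x : exists c, cell_set c x.
Proof.
case: x => [g|g s t|g r p].
- exists (inl (g, s0)); apply: cell_vertex; by left.
- exists (inl (g, s)); exists (val t).
    by have /andP[t0 t1] := valP t; rewrite /= in_itv /= !ltW.
  by rewrite /edge_map valK.
- exists (inr (g, r)); exists (val p).
    by have /and3P[t0 t1 t2] := valP p; split; apply: ltW.
  by rewrite /triangle_map valK.
Qed.

Lemma letter_map_rev g l t :
  @letter_map R G P (g * lval l)%g (l.1, ~~ l.2) t = letter_map g l (1 - t).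
Proof.
by case: l => s []; rewrite /letter_map /letter_val /= ?mulgK// opprB addrC subrK.
Qed.

Lemma letter_valN l : lval (l.1, ~~ l.2) = (lval l)^-1%g.
Proof. by case: l => s []; rewrite /letter_val /= ?invgK. Qed.

Lemma letter_map_edge g l t : 0 <= t <= 1 ->
  cell_set (inl (if l.2 then g else (g * (gen l.1)^-1)%g, l.1)) (letter_map g l t).
Proof.
by case: l => s [] t01; rewrite /letter_map /=;
  [exists t|exists (1 - t)]; rewrite //= in_itv /=; lra.
Qed.

Lemma letter_map_triangle g (r : {r | r \in relators P}) t : 0 <= t <= 1 ->
  [/\ cell_set (inr (g, r)) (letter_map (corner g (val r) 0) (tnth (val r) ord0) t),
      cell_set (inr (g, r))
        (letter_map (corner g (val r) 1) (tnth (val r) (inord 1)) t)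
    & cell_set (inr (g, r))
        (letter_map (corner g (val r) 2) (tnth (val r) ord_max) t)].
Proof.
move=> /andP[t0 t1].
have T0 : @triangle R (t, 0) by split => /=; lra.
have T1 : @triangle R (1 - t, t) by split => /=; lra.
have T2 : @triangle R (0, 1 - t) by split => /=; lra.
have [E0 E1 E2] := corner_steps g r; split.
- exists (t, 0) => //.
  by rewrite /triangle_map insubF ?ltxx ?andbF//= eqxx.
- exists (1 - t, t) => //.
  rewrite /triangle_map insubF /=; last by rewrite subrK ltxx !andbF.
  case: eqP => [->|_]; first by rewrite subr0 letter_map1 letter_map0 E0.
  by case: eqP => [/subr0_eq <-|//]; rewrite subrr letter_map1 letter_map0 E1.
- exists (0, 1 - t) => //.
  rewrite /triangle_map insubF /=; last by rewrite ltxx.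
  case: eqP => [/subr0_eq <-|_]; first by rewrite letter_map1 letter_map0 E2.
  by rewrite eqxx opprB addrC subrK.
Qed.

(** The last condition keeps the edge inside the cell: a letter joining two
    vertices of a triangle could otherwise be read along another edge. *)
Lemma cell_vertices_adj c v w : cell_vertices c v -> cell_vertices c w ->
  v = w \/ exists2 l, w = (v * lval l)%g &
    forall t, 0 <= t <= 1 -> cell_set c (letter_map v l t).
Proof.
pose adj v w := exists2 l, w = (v * lval l)%g &
    forall t, 0 <= t <= 1 -> cell_set c (letter_map v l t).
have adjS v' w' : adj v' w' -> adj w' v'.
  case=> l -> lc; exists (l.1, ~~ l.2).
    by rewrite letter_valN mulgK.
  by move=> t t01; rewrite letter_map_rev; apply: lc; lra.
case: c @adj adjS => [[g s]|[g r]] adj adjS.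
  have a : adj g (g * gen s)%g.
    exists (s, true) => // t t01; exact: (@letter_map_edge g (s, true)).
  case=> /= -> [] /= ->; by [left|right; exact: a|right; exact: adjS].
have [E0 E1 E2] := corner_steps g r.
have a0 : adj (corner g (val r) 0) (corner g (val r) 1).
  by eexists; [exact: E0|move=> t /(letter_map_triangle g r)[]].
have a1 : adj (corner g (val r) 1) (corner g (val r) 2).
  by eexists; [exact: E1|move=> t /(letter_map_triangle g r)[]].
have a2 : adj (corner g (val r) 2) (corner g (val r) 0).
  by eexists; [exact: E2|move=> t /(letter_map_triangle g r)[]].
case=> [[]|] /= -> [[]|] /= ->; by [left|right; exact: a0|right; exact: a1|right; exact: a2|right; exact: adjS].
Qed.

Lemma carrier_le b x : exists2 v, carrier x v & b v <= extend b x.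
Proof.
case: x => [g|g s t|g r p] /=.
- by exists g.
- have /andP[] := valP t => u0 u1.
  have [le|/ltW le] := lerP (b g) (b (g * gen s)%g).
    by exists g; [left|exact: le_conv2].
  by exists (g * gen s)%g; [right|exact: le_conv2].
- have /and3P[] := valP p => u0 w0 uw.
  set a0 := corner _ _ 0; set a1 := corner _ _ 1; set a2 := corner _ _ 2.
  have k : [\/ b a0 <= b a1 /\ b a0 <= b a2, b a1 <= b a0 /\ b a1 <= b a2 |
      b a2 <= b a0 /\ b a2 <= b a1].
    have [xy|/ltW xy] := lerP (b a0) (b a1); have [xz|/ltW xz] := lerP (b a0) (b a2);
    have [yz|/ltW yz] := lerP (b a1) (b a2).
    all: try by [constructor 1|constructor 2|constructor 3].
    by constructor 2; split => //; exact: le_trans yz _.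
    by constructor 3; split => //; exact: le_trans yz _.
  case: k => -[le1 le2].
  + by exists a0; [left; left|exact: le_conv3].
  + by exists a1; [left; right|exact: le_conv3].
  + by exists a2; [right|exact: le_conv3].
Qed.

Lemma extendN b x : extend (fun g => - b g) x = - extend b x.
Proof. by case: x => [g|g s t|g r p] /=; ring. Qed.

Lemma extendZ (c : R) b x : extend (fun g => c * b g) x = c * extend b x.
Proof. by case: x => [g|g s t|g r p] /=; ring. Qed.

Lemma carrier_ge b x : exists2 v, carrier x v & extend b x <= b v.
Proof.
have [v cv] := carrier_le (fun g => - b g) x.
by rewrite extendN lerN2; exists v.
Qed.

Lemma eq_extend b b' x : (forall v, carrier x v -> b v = b' v) ->
  extend b x = extend b' x.
Proof.
case: x => [g|g s t|g r p] /= e.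
- exact: e.
- by rewrite !e; [|right|left].
- by rewrite !e; [|right|left; right|left; left].
Qed.

Lemma extendB b b' (k : R) x :
  extend (fun g => b g - b' g - k) x = extend b x - extend b' x - k.
Proof. by case: x => [g|g s t|g r p] /=; ring. Qed.

(** The straight segment in the coordinates of the cell: all affine extensions
    are affine along it. *)
Lemma cell_path c x y : cell_set c x -> cell_set c y ->
  exists p : R -> K, [/\ {within `[0, 1], continuous p}, p 0 = x, p 1 = y,
    (forall t, 0 <= t <= 1 -> cell_set c (p t)) &
    forall b t, 0 <= t <= 1 ->
      extend b (p t) = (1 - t) * extend b x + t * extend b y].
Proof.
case: c => [[g s]|[g r]] /=.
  move=> [u u01 <-] [w w01 <-].
  exists (fun t => @edge_map R G P g s ((1 - t) * u + t * w)).
  rewrite /= !in_itv /= in u01 w01.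
  have I t : 0 <= t <= 1 -> 0 <= (1 - t) * u + t * w <= 1.
    move: u01 w01 => /andP[u0 u1] /andP[w0 w1] /andP[t0 t1].
    by apply/andP; split; nra.
  split=> [||||b t t01].
  - have cf : {within `[0, 1], continuous (fun t : R => (1 - t) * u + t * w)}.
      apply: continuous_subspaceT; exact: conv_continuous.
    have sub : (fun t : R => (1 - t) * u + t * w) @` `[0, 1] `<=` `[0, 1].
      by move=> _ [t + <-]; rewrite /= !in_itv /=; exact: I.
    exact: (within_comp cf sub (@edge_map_continuous R G P g s)).
  - by congr edge_map; ring.
  - by congr edge_map; ring.
  - by move=> t /I t01; exists ((1 - t) * u + t * w) => //=; rewrite in_itv.
  - by rewrite !extend_edge// ?I//; ring.
move=> [u uT <-] [w wT <-].
pose q t := ((1 - t) * u.1 + t * w.1, (1 - t) * u.2 + t * w.2).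
have I t : 0 <= t <= 1 -> triangle (q t).
  by move: uT wT => [? ? ?] [? ? ?] /andP[t0 t1]; split; rewrite /q /=; nra.
exists (fun t => triangle_map g r (q t)); split=> [||||b t t01].
- have cq : continuous q.
    by move=> t; exact: (cvg_pair (@conv_continuous R u.1 w.1 t) (@conv_continuous R u.2 w.2 t)).
  have cf : {within `[0, 1], continuous q} by exact: (continuous_subspaceT cq).
  have sub : q @` `[0, 1] `<=` @triangle R.
    by move=> _ [t + <-]; rewrite /= in_itv /=; exact: I.
  exact: (within_comp cf sub (@triangle_map_continuous R G P g r)).
- by rewrite /q !subr0 !mul1r !mul0r !addr0 -surjective_pairing.
- by rewrite /q !subrr !mul0r !mul1r !add0r -surjective_pairing.
- by move=> t /I t01; exists (q t).
- by rewrite !extend_triangle//; [rewrite /q /=; ring|exact: I].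
Qed.

(** The preimage of [A] in a closed cell is empty or the whole preimage of [Z]. *)
Lemma saturated_closed (Z A : set K) : closed Z -> A `<=` Z ->
  (forall c x y, cell_set c x -> cell_set c y -> Z y -> A x -> A y) ->
  closed A.
Proof.
move=> cZ AZ sat.
have key (T : topologicalType) (D : set T) (q : T -> K) c :
    {within D, continuous q} -> q @` D = cell_set c ->
    closed (q @^-1` A : set (subspace D)).
  move=> /continuous_closedP cq qD; apply: closed_subspaceI.
  have inc u : D u -> cell_set c (q u) by move=> Du; rewrite -qD; exists u.
  have [[u [Du Au]]|no] := pselect (exists u, D u /\ A (q u)).
    rewrite (_ : _ `&` _ = D `&` (q @^-1` Z)).
      by apply: closedI; [exact: closed_subspaceT|exact: cq].
    apply/seteqP; split=> w [Dw] /= Aw; split => //; first exact: AZ.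
    by apply: (sat c (q u)) => //; exact: inc.
  rewrite (_ : _ `&` _ = set0); first exact: closed0.
  by apply/seteqP; split=> // w [Dw Aw]; apply: no; exists w.
rewrite -openC; split=> g x; rewrite preimage_setC openC.
- exact: (key _ _ _ (inl (g, x)) (@edge_map_continuous R G P g x)).
- exact: (key _ _ _ (inr (g, x)) (@triangle_map_continuous R G P g x)).
Qed.

(** Both [A] and its complement in [Z] are saturated, hence closed: a connected
    subset of [Z] can only be explored from cell to cell. *)
Lemma saturated_connected (Z A C : set K) : closed Z -> A `<=` Z ->
  (forall c x y, cell_set c x -> cell_set c y -> Z y -> A x -> A y) ->
  connected C -> C `<=` Z -> C `&` A !=set0 -> C `<=` A.
Proof.
move=> cZ AZ sat conC CZ [x [Cx Ax]].
have cA := saturated_closed cZ AZ sat.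
have cB : closed (Z `\` A).
  apply: saturated_closed cZ _ _ => [y []//|c y z cy cz Zz [Zy nAy]].
  by split=> // Az; apply: nAy; exact: sat cz cy _ Az.
have -> : C = C `&` A; last by move=> ? [].
apply/esym/conC; first by exists x.
- exists (~` (Z `\` A)); first by rewrite openC.
  apply/seteqP; split=> y [Cy] Ay; split=> //; first by case.
  by apply: contrapT => nA; apply: Ay; split=> //; exact: CZ.
- by exists A.
Qed.

End closed_cells.
(** * Tracks *)

(** The properties of the scaled pseudocharacter on which the geometry rests;
    [d] is its defect. By [tame_climb] there is a generator such that right
    multiplication by it increases [f] at every element. *)
Record tame (R : realType) (G : groupType) (P : tri_presentation G)
    (f : G -> R) (d : R) : Prop := Tame {
  tame_defect : forall g h, `|f g + f h - f (g * h)%g| <= d;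
  tame_gen : forall s : generators P, `|f (gen s)| + d < 1 / 4;
  tame_climb : exists s : generators P, d < f (gen s);
  tame_half : forall g (n : int), f g <> n%:~R + 2^-1
}.

Lemma int_eq (R : realDomainType) (m n : int) : `|m%:~R - n%:~R : R| < 1 -> m = n.
Proof.
rewrite -intrB -intr_norm (_ : 1 = 1%:~R :> R)// ltr_int.
by move=> h; apply/eqP; rewrite -subr_eq0 -normr_eq0; lia.
Qed.

Lemma common_int (m n : int) : `|m - n| < 2 ->
  exists k : int, (m <= k <= m + 1) && (n <= k <= n + 1).
Proof. by move=> h; exists (if m <= n then n else m); case: ifP; lia. Qed.

Section tracks.
Variables (R : realType) (G : groupType) (P : tri_presentation G).
Notation K := (cover_complex R P).
Notation lval := (letter_val (@gen G P)).
Variables (f : G -> R) (d : R).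
Hypothesis tf : tame P f d.
Implicit Types (g h v : G) (x y : K) (T C : set K) (n : int).

Notation fx := (extend f : K -> R).
Notation H := (@half_integer_levels R G P f).

Lemma tame_d_itv : 0 <= d < 1 / 4.
Proof.
have d0 := le_trans (normr_ge0 _) (tame_defect tf 1%g 1%g).
have [s _] := tame_climb tf; have := tame_gen tf s.
have := normr_ge0 (f (gen s)); lra.
Qed.

Lemma letter_step g l : `|f (g * lval l)%g - f g| < 1 / 4.
Proof.
have := tame_gen tf l.1; case: l => s [] /=; rewrite /letter_val /=.
  have := tame_defect tf g (gen s).
  rewrite !ler_norml !ltr_norml => /andP[? ?].
  by have := ler_norm (f (gen s)); have := ler_norm (- f (gen s)); rewrite normrN => ? ? ?; lra.
have := tame_defect tf (g * (gen s)^-1)%g (gen s); rewrite mulgVK.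
rewrite !ler_norml !ltr_norml => /andP[? ?].
by have := ler_norm (f (gen s)); have := ler_norm (- f (gen s)); rewrite normrN => ? ? ?; lra.
Qed.

(** Vertices of a cell are adjacent, and [f] changes by at most
    [|f s| + d < 1/4] along an edge. *)
Lemma cell_close c x y : cell_set c x -> cell_set c y -> `|fx x - fx y| < 1 / 4.
Proof.
have vc v w : cell_vertices c v -> cell_vertices c w -> `|f v - f w| < 1 / 4.
  move=> cv cw; have [->|[l -> _]] := cell_vertices_adj R cw cv; last exact: letter_step.
  by rewrite subrr normr0; lra.
move=> cx cy.
have [v /(cell_carrier cx) cv vx] := carrier_le f x.
have [v' /(cell_carrier cx) cv' vx'] := carrier_ge f x.
have [w /(cell_carrier cy) cw wy] := carrier_le f y.
have [w' /(cell_carrier cy) cw' wy'] := carrier_ge f y.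
have := vc _ _ cv' cw; have := vc _ _ cv cw'; rewrite !ltr_norml; lra.
Qed.

(** At the vertices this is the definition of the defect; elsewhere it follows
    by convexity. *)
Lemma translate_close h x : `|fx (translate h x) - fx x - f h| <= d.
Proof.
pose b g := f (h * g)%g - f g - f h.
rewrite (_ : _ - _ - _ = extend b x); last by rewrite extend_translate -extendB.
have bd g : `|b g| <= d.
  rewrite -normrN (_ : - b g = f h + f g - f (h * g)%g); last by rewrite /b; ring.
  exact: tame_defect tf h g.
have [v _ vx] := carrier_le b x; have [w _ wx] := carrier_ge b x.
have := bd v; have := bd w; rewrite !ler_norml; lra.
Qed.

Lemma fx_continuous : continuous fx.
Proof. exact: extend_continuous. Qed.

Lemma connected_between C (b : G -> R) x y r : connected C -> C x -> C y ->
  extend b x <= r <= extend b y -> exists2 z, C z & extend b z = r.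
Proof.
move=> cC Cx Cy xry.
have : connected (extend b @` C).
  apply: connected_continuous_connected => //.
  by apply: continuous_subspaceT; exact: extend_continuous.
move=> /connected_intervalP/(_ (extend b x) (extend b y)).
move=> /(_ (ex_intro2 _ _ x Cx erefl) (ex_intro2 _ _ y Cy erefl) _ xry).
by case=> z; exists z.
Qed.

(** The image of [C] is an interval, and between two half-integers there is an
    integer. *)
Lemma half_level_eq C x y : connected C -> C `<=` H -> C x -> C y -> fx x = fx y.
Proof.
move=> cC CH.
wlog xy : x y / fx x <= fx y => [hw Cx Cy|Cx Cy].
  by have [h|/ltW h] := lerP (fx x) (fx y); [|apply/esym]; exact: hw h _ _.
have [n ex] := CH _ Cx; have [m ey] := CH _ Cy.
have [/eqP|nm] := eqVneq n m; first by move=> /eqP e; rewrite ex ey e.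
have lt : (n < m)%R.
  rewrite lt_neqAle nm -(ler_int R); move: xy; rewrite ex ey; lra.
have le : ((n + 1)%:~R <= m%:~R :> R) by rewrite ler_int; lia.
have [z Cz ez] : exists2 z, C z & fx z = (n + 1)%:~R.
  apply: connected_between cC Cx Cy _; rewrite ex ey; move: le; rewrite intrD; lra.
have [k] := CH _ Cz; rewrite ez => e.
have : `|(n + 1)%:~R - k%:~R : R| < 1 by rewrite e ltr_norml; lra.
by move=> /int_eq ek; move: e; rewrite ek; lra.
Qed.

Lemma trackP T : tracks f T -> exists n, [/\ connected T, T !=set0,
   forall x, T x -> fx x = n%:~R + 2^-1 &
   forall C x, connected C -> C `<=` H -> C x -> T x -> C `<=` T].
Proof.
move=> [x0 [n e0] <-]; have Hx0 : H x0 by exists n.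
exists n; split.
- exact: component_connected.
- by exists x0; exact: connected_component_refl.
- move=> x Tx; rewrite -e0; apply: half_level_eq (@component_connected _ H x0) _ Tx _.
    exact: connected_component_sub.
  exact: connected_component_refl.
- move=> C x cC CH Cx Tx y Cy; apply: connected_component_trans Tx _.
  by exists C.
Qed.

Lemma same_level c x y : cell_set c x -> cell_set c y -> H x -> H y -> fx x = fx y.
Proof.
move=> cx cy [n ex] [m ey]; have := cell_close cx cy; rewrite ex ey => h.
suff -> : n = m by [].
apply: (@int_eq R); move: h; rewrite !ltr_norml; lra.
Qed.

Lemma level_path c x y : cell_set c x -> cell_set c y -> H x -> H y ->
  exists C, [/\ connected C, C `<=` H, C `<=` cell_set c, C x & C y].
Proof.
move=> cx cy Hx Hy; have e := same_level cx cy Hx Hy.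
have [p [cp p0 p1 pc pe]] := cell_path cx cy.
have I0 : `[(0:R), 1]%classic 0 by rewrite /= in_itv /= lexx ler01.
have I1 : `[(0:R), 1]%classic 1 by rewrite /= in_itv /= lexx ler01.
exists (p @` `[0, 1]); split.
- apply: connected_continuous_connected => //; exact: segment_connected.
- move=> _ [t + <-]; rewrite /= in_itv /= => t01.
  have [n ex] := Hx; exists n; rewrite -ex pe// -e; ring.
- by move=> _ [t + <-]; rewrite /= in_itv /= => t01; exact: pc.
- by exists 0.
- by exists 1.
Qed.

(** A cell meets a level in a convex set, and it meets at most one of the
    half-integral levels. *)
Lemma track_cell T c x y : tracks f T -> cell_set c x -> cell_set c y ->
  T x -> H y -> T y.
Proof.
move=> /trackP[n [cT _ lT mT]] cx cy Tx Hy.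
have Hx : H x by exists n; exact: lT.
by have [C [cC CH _ Cx Cy]] := level_path cx cy Hx Hy; exact: (mT C x).
Qed.

(** Induction along a track, from cell to cell. *)
Lemma track_ind T (A : set K) x0 : tracks f T -> T x0 -> A x0 ->
  (forall c x y, cell_set c x -> cell_set c y -> T x -> T y -> A x -> A y) ->
  T `<=` A.
Proof.
move=> tT Tx0 Ax0 ind; have [n [cT _ lT mT]] := trackP tT.
pose Z := fx @^-1` [set n%:~R + 2^-1].
have cZ : closed Z.
  have /continuous_closedP := fx_continuous; apply; exact: closed_eq.
suff : T `<=` T `&` A by move=> h x /h[].
apply: (saturated_connected cZ) cT _ _.
- by move=> x [/lT].
- move=> c x y cx cy Zy [Tx Ax]; have Ty : T y by apply: track_cell tT cx cy Tx _; exists n.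
  by split=> //; exact: ind cx cy Tx Ty Ax.
- by move=> x /lT.
- by exists x0.
Qed.

End tracks.
(** * Tracks separate the complex *)

(** The size of a list is the sum of the multiplicities of its entries. *)
Lemma odd_size_count (T : eqType) (s : seq T) :
  odd (size s) -> exists2 x, x \in s & odd (count_mem x s).
Proof.
have [n] := ubnP (size s); elim: n s => // n IH [//|x s] /= ns os.
have [ox|e] := boolP (odd (count_mem x (x :: s))).
  by exists x => //; rewrite mem_head.
pose s' := [seq y <- s | y != x].
have sz : (size s' + count_mem x (x :: s) = (size s).+1)%N.
  have := count_predC (pred1 x) s; rewrite size_filter /= eqxx.
  have -> : count (fun y => y != x) s = count (predC (pred1 x)) s by [].
  by move=> <-; lia.
have [| |y] := IH s'.
- by have := count_size (fun y => y != x) s; rewrite /s' size_filter; lia.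
- by move: (congr1 odd sz); rewrite oddD (negbTE e) addbF /= => ->.
rewrite mem_filter => /andP[yx ys] oy; exists y; first by rewrite inE ys orbT.
rewrite /= eq_sym (negbTE yx) add0n; move: oy; rewrite count_filter.
rewrite (@eq_count _ _ (pred1 y))// => z /=; case: eqP => [->|//]; by rewrite yx.
Qed.

Lemma lt_conv (R : realDomainType) (x y m t : R) : m < x -> m < y ->
  0 <= t <= 1 -> m < (1 - t) * x + t * y.
Proof.
move=> mx my /andP[t0 t1].
have -> : (1 - t) * x + t * y = m + ((1 - t) * (x - m) + t * (y - m)) by ring.
rewrite ltrDl; have [->|tn] := eqVneq t 0; first by lra.
by rewrite ltr_wpDl ?mulr_ge0 ?mulr_gt0 ?lt0r ?tn//; lra.
Qed.

Section sides.
Variables (R : realType) (G : groupType) (P : tri_presentation G).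
Notation K := (cover_complex R P).
Notation letter := (generators P * bool)%type.
Notation lval := (letter_val (@gen G P)).
Notation wval := (word_val (@gen G P)).
Variables (f : G -> R) (d : R).
Hypothesis tf : tame P f d.
Implicit Types (g h v : G) (x y : K) (T C : set K) (n : int) (l : letter).

Notation fx := (extend f : K -> R).
Notation H := (@half_integer_levels R G P f).

Definition crosses T g l : bool :=
  `[< exists2 t : R, 0 <= t <= 1 & T (letter_map g l t) >].

Fixpoint crossing_parity T g (w : seq letter) : bool :=
  if w is l :: w' then crosses T g l (+) crossing_parity T (g * lval l)%g w' else false.

Lemma crossing_parity_cat T g w w' :
  crossing_parity T g (w ++ w') = crossing_parity T g w (+) crossing_parity T (g * wval w)%g w'.
Proof.
elim: w g => [|l w IH] g /=; first by rewrite /word_val big_nil mulg1.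
by rewrite IH /word_val big_cons mulgA addbA.
Qed.

Lemma crosses_rev T g l : crosses T (g * lval l)%g (l.1, ~~ l.2) = crosses T g l.
Proof.
apply/asboolP/asboolP => -[t t01 Tt]; exists (1 - t); try lra.
- by rewrite -letter_map_rev.
- by rewrite letter_map_rev opprB addrC subrK.
Qed.

Definition above n g : bool := n%:~R + 2^-1 < f g.

Lemma aboveN n g : ~~ above n g -> f g < n%:~R + 2^-1.
Proof.
by rewrite -leNgt le_eqVlt => /orP[/eqP/(tame_half tf)|].
Qed.

Lemma straddle n g l : above n g (+) above n (g * lval l)%g ->
  exists2 t : R, 0 <= t <= 1 & fx (letter_map g l t) = n%:~R + 2^-1.
Proof.
move=> s.
(* The crossing point has parameter [s1 / s2]. *)
have [s1 [s2 [s2p s1p e]]] : exists c1 c2 : R, [/\ 0 < c2, 0 <= c1 <= c2 &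
    (c2 - c1) * f g + c1 * f (g * lval l)%g = c2 * (n%:~R + 2^-1)].
  move: s; case: (boolP (above n g)) => /= [a /aboveN b|/aboveN a].
    exists (f g - (n%:~R + 2^-1)), (f g - f (g * lval l)%g); rewrite /above in a; 
    by split; [lra|lra|ring].
  rewrite /above => b.
  exists (n%:~R + 2^-1 - f g), (f (g * lval l)%g - f g); split; [lra|lra|ring].
have s01 : 0 <= s1 / s2 <= 1.
  by apply/andP; split; [rewrite divr_ge0//; lra|rewrite ler_pdivrMr// mul1r; lra].
exists (s1 / s2) => //; rewrite extend_letter//.
have n0 : s2 != 0 by rewrite gt_eqF.
by apply: (mulfI n0); rewrite -e; field.
Qed.

Lemma no_straddle n g l t : above n g = above n (g * lval l)%g -> 0 <= t <= 1 ->
  fx (letter_map g l t) <> n%:~R + 2^-1.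
Proof.
move=> e t01; rewrite extend_letter// => q.
move: e; case: (boolP (above n g)) => [a /esym b|/aboveN + /esym/negbT/aboveN].
  by have := lt_conv a b t01; rewrite q ltxx.
move=> a b.
have := @lt_conv R (- f g) (- f (g * lval l)%g) (- (n%:~R + 2^-1)) t.
by rewrite !ltrN2 => /(_ a b t01); lra.
Qed.

Section one_track.
Variables (T : set K) (n : int).
Hypotheses (tT : tracks f T) (Tn : forall x, T x -> fx x = n%:~R + 2^-1).

Definition meets (c : cell P) : bool := `[< exists2 x, cell_set c x & T x >].

(** All points of a cell at the level of [T] are in [T] as soon as one of them
    is, so only the positions of the end points relative to the level matter. *)
Lemma crosses_cell c g l : (forall t, 0 <= t <= 1 -> cell_set c (letter_map g l t : K)) ->
  crosses T g l = meets c && (above n g (+) above n (g * lval l)%g).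
Proof.
move=> lc; apply/asboolP/andP => [[t t01 Tt]|[/asboolP[x cx Tx] s]].
  split; first by apply/asboolP; exists (letter_map g l t) => //; exact: lc.
  apply/negPn/negP; rewrite negb_add => /eqP e.
  exact: no_straddle e t01 (Tn Tt).
have [t t01 e] := straddle s; exists t => //.
by apply: (track_cell tf tT cx (lc _ t01) Tx); exists n.
Qed.

(** Among the three sides of a triangle an even number straddle the level. *)
Lemma crossing_parity_relator g (r : {r | r \in relators P}) : crossing_parity T g (val r) = false.
Proof.
have [E0 E1 E2] := corner_steps g r.
have lc t (t01 : 0 <= t <= 1) := @letter_map_triangle R G P g r t t01.
have c0 := @crosses_cell (inr (g, r)) _ _ (fun t t01 => let: And3 x _ _ := lc t t01 in x).
have c1 := @crosses_cell (inr (g, r)) _ _ (fun t t01 => let: And3 _ x _ := lc t t01 in x).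
have c2 := @crosses_cell (inr (g, r)) _ _ (fun t t01 => let: And3 _ _ x := lc t t01 in x).
have x0 : letter := tnth (val r) ord0.
have -> : val r = [:: tnth (val r) ord0; tnth (val r) (inord 1); tnth (val r) ord_max] :> seq _.
  apply: (@eq_from_nth _ x0); first by rewrite size_tuple.
  by rewrite size_tuple => -[|[|[|i]]] //= _; rewrite (tnth_nth x0) ?inordK.
rewrite /= addbF; rewrite -E0 -E1 -E2 in c0 c1 c2; rewrite corner0 in E0 c0.
rewrite c0 -E0 c1 -E1 c2 corner0.
by case: (meets _); case: (above _ _); case: (above _ _); case: (above _ _).
Qed.

(** This is where simple connectedness of the complex enters. *)
Lemma crossing_parity_word_eq w w' g : word_eq (relators P) w w' ->
  crossing_parity T g w = crossing_parity T g w'.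
Proof.
move=> e; elim: e g => {w w'} [//|w w' _ IH g|w1 w2 w3 _ IH1 _ IH2 g|u v s b g|u v r rP g].
- exact/esym/IH.
- by rewrite IH1 IH2.
- rewrite !crossing_parity_cat; congr (_ (+) _); rewrite /= addbF.
  have -> := crosses_rev T (g * wval u)%g (s, b); rewrite addbb addFb; congr crossing_parity.
  rewrite /word_val !big_cons big_nil mulg1.
  by have -> := @letter_valN G P (s, b); rewrite mulgV mulg1.
- rewrite !crossing_parity_cat (crossing_parity_relator _ (exist _ r rP)) addFb.
  by have -> := relator_val (exist _ r rP); rewrite mulg1.
Qed.

Definition track_side g : bool := crossing_parity T 1%g (projT1 (cid (gen_surj P g))).

Lemma track_side_word g w : track_side (g * wval w)%g = track_side g (+) crossing_parity T g w.
Proof.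
rewrite /track_side; case: (cid _) => u /= eu; case: (cid _) => u' /= eu'.
have -> : crossing_parity T g w = crossing_parity T (1 * wval u')%g w by rewrite mul1g eu'.
rewrite -crossing_parity_cat; apply: crossing_parity_word_eq; apply/presentsP.
by rewrite eu -[in LHS]eu' /word_val big_cat.
Qed.

Lemma track_side_cell c v w : cell_vertices c v -> cell_vertices c w ->
  track_side w = track_side v (+) (meets c && (above n v (+) above n w)).
Proof.
move=> cv cw; have [->|[l -> lc]] := cell_vertices_adj R cv cw.
  by rewrite addbb andbF addbF.
have := track_side_word v [:: l]; rewrite /= addbF /word_val big_seq1 => ->.
by rewrite (crosses_cell lc).
Qed.

(** On the cells met by the track this is [f - (n + 1/2)] up to a constant sign;
    on the others its sign is constant. Hence its affine extension vanishes only
    on the track. *)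
Definition height g : R := (-1) ^+ track_side g * `|f g - (n%:~R + 2^-1)|.

Lemma height_above g : height g = (-1) ^+ (track_side g (+) above n g) * - (f g - (n%:~R + 2^-1)).
Proof.
rewrite /height signr_addb -mulrA; congr (_ * _).
have [a|/aboveN a] := boolP (above n g); rewrite /= ?expr1 ?expr0.
  rewrite gtr0_norm ?mulN1r ?opprK//; rewrite /above in a; lra.
by rewrite ltr0_norm ?mul1r//; lra.
Qed.

Lemma height_zero x : extend height x = 0 -> T x.
Proof.
have [s0 _] := tame_climb tf; have [c cx] := cell_cover s0 x.
have [v /(cell_carrier cx) cv _] := carrier_le f x.
have [m|m] := boolP (meets c).
  (* In a cell met by the track the height is [k * (f - (n + 1/2))]. *)
  pose k : R := - (-1) ^+ (track_side v (+) above n v).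
  have -> : extend height x = extend (fun g => k * (f g - 0 - (n%:~R + 2^-1))) x.
    apply: eq_extend => w /(cell_carrier cx) cw; rewrite height_above /k 
      (track_side_cell cv cw) m /=.
    rewrite (_ : _ (+) above n w = track_side v (+) above n v); first by ring.
    by case: (track_side v); case: (above n v); case: (above n w).
  rewrite extendZ (@extendB _ _ _ f (fun=> 0)) => /eqP.
  rewrite mulf_eq0 oppr_eq0 signr_eq0 /= => e0.
  have {}e0 : fx x = n%:~R + 2^-1.
    move: e0; rewrite (_ : extend (fun=> 0) x = 0); last by case: (x) => [g|g s t|g r p] /=; ring.
    by rewrite subr0 subr_eq0 => /eqP.
  move: m => /asboolP[y cy Ty].
  by apply: (track_cell tf tT cy cx Ty); exists n.
move=> e; exfalso.
(* In the other cells [k * height] is positive at all vertices. *)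
pose k : R := (-1) ^+ track_side v.
have [w /(cell_carrier cx) cw] := carrier_le (fun g => k * height g) x.
rewrite extendZ e mulr0 /height (track_side_cell cv cw) (negbTE m) /= addbF /k mulrA.
rewrite -expr2 sqrr_sign mul1r normr_le0 subr_eq0 => /eqP.
exact: tame_half tf _ _.
Qed.

Lemma height_side g : (height g < 0) = track_side g /\ (0 < height g) = ~~ track_side g.
Proof.
have p : 0 < `|f g - (n%:~R + 2^-1)|.
  rewrite normr_gt0 subr_eq0; apply/eqP; exact: tame_half tf _ _.
by rewrite /height; case: (track_side g); rewrite ?expr1 ?expr0 ?mulN1r ?mul1r ?oppr_lt0 ?oppr_gt0 p;
  split=> //; apply/negbTE; rewrite -leNgt ltW.
Qed.

End one_track.

Definition track_at n g l : set K :=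
  connected_component H (letter_map g l (xget 0 [set t : R |
    0 <= t <= 1 /\ fx (letter_map g l t) = n%:~R + 2^-1])).

Fixpoint track_word n g (w : seq letter) : seq (set K) :=
  if w is l :: w' then
    (if above n g (+) above n (g * lval l)%g then [:: track_at n g l] else [::])
      ++ track_word n (g * lval l)%g w'
  else [::].

Lemma track_atP n g l : above n g (+) above n (g * lval l)%g ->
  [/\ tracks f (track_at n g l),
     (forall x, track_at n g l x -> fx x = n%:~R + 2^-1) &
     exists2 t : R, 0 <= t <= 1 & track_at n g l (letter_map g l t)].
Proof.
move=> /straddle[t0 t01 e].
have := @xgetI _ 0 [set t : R | 0 <= t <= 1 /\ fx (letter_map g l t) = n%:~R + 2^-1] t0 (conj t01 e).
rewrite /track_at; set t := xget _ _ => -[t01' e'].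
have Ht : H (letter_map g l t) by exists n.
have r := @connected_component_refl _ _ _ Ht.
split; last by exists t.
- by exists (letter_map g l t).
- move=> x Tx; rewrite -e'.
  exact: (half_level_eq (@component_connected _ H _) (@connected_component_sub _ H _) Tx r).
Qed.

Lemma track_word_count n T g w : tracks f T ->
  (forall x, T x -> fx x = n%:~R + 2^-1) ->
  crossing_parity T g w = odd (count_mem T (track_word n g w)).
Proof.
move=> tT Tn; elim: w g => [//|l w IH] g /=.
rewrite count_cat oddD IH; congr (_ (+) _).
have [s|s] := boolP (above n g (+) above n (g * lval l)%g); last first.
  apply/negbTE/negP => /asboolP[t t01 /Tn].
  by apply: no_straddle t01; move: s; rewrite negb_add => /eqP.
have [tA An [t t01 At]] := track_atP s.
rewrite (crosses_cell tT Tn (@letter_map_edge R G P g l)) s andbT /= addn0 oddb.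
apply/asboolP/eqP => [[x cx Tx]|<-].
  have Tt : T (letter_map g l t).
    by apply: (track_cell tf tT cx (letter_map_edge g l t01) Tx); exists n; exact: An.
  have [_ [_ _ _ mT]] := trackP tT; have [_ [_ _ _ mA]] := trackP tA.
  have [m [cT _ lT _]] := trackP tT; have [m' [cA _ lA _]] := trackP tA.
  apply/seteqP; split; [apply: mT cA _ At Tt|apply: mA cT _ Tt At].
    by move=> y /lA; exists m'.
  by move=> y /lT; exists m.
by exists (letter_map g l t) => //; exact: letter_map_edge.
Qed.

Lemma track_word_size n g w :
  odd (size (track_word n g w)) = above n g (+) above n (g * wval w)%g.
Proof.
elim: w g => [|l w IH] g /=; first by rewrite /word_val big_nil mulg1 addbb.
rewrite size_cat oddD IH /word_val big_cons mulgA.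
by case: ifP; case: (above n g); case: (above n _) => //=; case: (above n _).
Qed.

Lemma track_word_tracks n g w T : T \in track_word n g w ->
  tracks f T /\ forall x, T x -> fx x = n%:~R + 2^-1.
Proof.
elim: w g => [//|l w IH] g /=; rewrite mem_cat => /orP[|/IH//].
by case: ifP => // /track_atP[? ? _]; rewrite inE => /eqP->.
Qed.

(** An edge path from [g] to [h] crosses the level an odd number of times, hence
    crosses some track of this level an odd number of times. *)
Lemma separating_track n g h : f g < n%:~R + 2^-1 < f h \/ f h < n%:~R + 2^-1 < f g ->
  exists T (a : G -> R), [/\ tracks f T, (forall x, T x -> fx x = n%:~R + 2^-1),
    (forall x, extend a x = 0 -> T x), a g < 0 & 0 < a h].
Proof.
move=> lt; have [w ew] := gen_surj P (g^-1 * h)%g.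
have [T /track_word_tracks[tT Tn]] : exists2 T, T \in track_word n g w &
    odd (count_mem T (track_word n g w)).
  apply: odd_size_count; rewrite track_word_size ew mulVKg /above.
  by case: lt => /andP[l1 l2]; rewrite l2 (ltNge _ (f _)) (ltW l1).
rewrite -track_word_count// => pw.
have := track_side_word tT Tn g w; rewrite ew mulVKg pw addbT => s.
have [sg sg'] := height_side T n g; have [sh sh'] := height_side T n h.
have [e|e] := boolP (track_side T g).
  exists T, (height T n); split => //; first exact: height_zero.
    by rewrite sg.
  by rewrite sh' s e.
exists T, (fun v => - height T n v); split => //.
- by move=> x; rewrite extendN => /eqP; rewrite oppr_eq0 => /eqP; exact: height_zero.
- by rewrite oppr_lt0 sg'.
- by rewrite oppr_gt0 sh s e.
Qed.

End sides.
(** * Distances between the vertices of a metric graph *)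

Section graph_distance.
Variables (R : realType) (T : eqType) (adj : T -> T -> Prop).
Hypothesis adj_sym : forall v w, adj v w -> adj w v.
Implicit Types (v w u : T) (n : nat).

Notation pt := (graph_point R adj).

(** Equality is allowed because two translated tracks that lie in a common
    connected set may belong to the same vertex. *)
Definition step v w := v = w \/ adj v w.

Fixpoint walk n v w : Prop :=
  if n is n'.+1 then exists2 u, step v u & walk n' u w else v = w.

Lemma walk_cat n n' v u w : walk n v u -> walk n' u w -> walk (n + n') v w.
Proof.
elim: n v => [v -> //|n IH v /= [x vx xu] uw].
by exists x => //; exact: IH.
Qed.

Lemma step_sym v w : step v w -> step w v.
Proof. by case=> [->|/adj_sym]; [left|right]. Qed.

Lemma walk_sym n v w : walk n v w -> walk n w v.
Proof.
elim: n v => [v -> //|n IH v [u /step_sym vu /IH uw]].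
by rewrite -addn1; apply: walk_cat uw _; exists v.
Qed.

Hypothesis walk_conn : forall v w, exists n, walk n v w.

Lemma walk_connb v w : exists n, `[< walk n v w >].
Proof. by have [n nw] := walk_conn v w; exists n; exact/asboolP. Qed.

Definition gdist v w : nat := ex_minn (walk_connb v w).

Lemma gdist_walk v w : walk (gdist v w) v w.
Proof. by rewrite /gdist; case: ex_minnP => n /asboolP. Qed.

Lemma gdist_le n v w : walk n v w -> (gdist v w <= n)%N.
Proof. by move=> nw; rewrite /gdist; case: ex_minnP => k _; apply; exact/asboolP. Qed.

Lemma gdistC v w : gdist v w = gdist w v.
Proof. by apply/eqP; rewrite eqn_leq !gdist_le//; exact/walk_sym/gdist_walk. Qed.

Lemma gdist_triangle v u w : (gdist v w <= gdist v u + gdist u w)%N.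
Proof. by apply/gdist_le/walk_cat; exact: gdist_walk. Qed.

Lemma gdist_step v w : step v w -> (gdist v w <= 1)%N.
Proof. by move=> vw; apply: gdist_le; exists w. Qed.

Lemma vertex_pointP v : exists a b (t : R), [/\ a = b \/ adj a b, 0 <= t <= 1 &
  segment_point v v 0 = segment_point a b t].
Proof. by exists v, v, 0; split; [left|rewrite lexx ler01|]. Qed.

Definition vertex_point v : pt := GraphPoint (vertex_pointP v).

(** Both sides are the sum of the values of [p] weighted by the barycentric
    coordinates of the same point. *)
Lemma segment_point_value (p : T -> R) v w t v' w' t' :
  segment_point v w t = segment_point v' w' t' :> (T -> R) ->
  (1 - t) * p v + t * p w = (1 - t') * p v' + t' * p w'.
Proof.
(* Duplicates are removed so that each vertex contributes once to the sum. *)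
move=> e; pose s := undup [:: v; w; v'; w'].
have us : uniq s by exact: undup_uniq.
have S x : x \in s -> \sum_(u <- s) (u == x)%:R * p u = p x.
  move=> xs; rewrite (bigD1_seq x)//= eqxx mul1r big1 ?addr0// => u /negbTE->.
  by rewrite mul0r.
have sv x y r : x \in s -> y \in s ->
    \sum_(u <- s) segment_point x y r u * p u = (1 - r) * p x + r * p y.
  move=> xs ys; rewrite -[in RHS](S x xs) -[in RHS](S y ys) !mulr_sumr -big_split /=.
  apply: eq_bigr => u _; rewrite /segment_point !indicE !in_set1; ring.
by rewrite -!sv ?e//; rewrite mem_undup !inE eqxx ?orbT.
Qed.

(** The affine extension of a 1-Lipschitz function on the vertices is
    1-Lipschitz. For the distance to a vertex this bounds [path_dist] from
    below. *)
Lemma chain_lipschitz (p : T -> R) (x z : pt) l :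
  (forall v w, adj v w -> `|p v - p w| <= 1) -> chain_length x z l ->
  forall v w t v' w' t', bary x = segment_point v w t ->
    bary z = segment_point v' w' t' ->
  `|((1 - t) * p v + t * p w) - ((1 - t') * p v' + t' * p w')| <= l.
Proof.
move=> lip; elim=> {x z l} [x v w t v' w' t' ex ez|x y z v w s t l vw s01 t01 ex ey _ IH].
  by rewrite (@segment_point_value p v w t v' w' t') -?ex// subrr normr0.
move=> v1 w1 r v' w' t' ex' ez.
have := IH v w t v' w' t' ey ez.
rewrite (@segment_point_value p v1 w1 r v w s) -?ex// => h.
set A := (1 - t') * _ + _ in h *.
have -> : (1 - s) * p v + s * p w - A = (s - t) * (p w - p v) + ((1 - t) * p v + t * p w - A) by ring.
apply: le_trans (ler_normD _ _) _; apply: lerD => //.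
by rewrite normrM ler_piMr// distrC lip.
Qed.

Lemma chain_ge0 (x z : pt) l : chain_length x z l -> 0 <= l.
Proof. by elim=> // *; rewrite addr_ge0. Qed.

Lemma chain_walk n v w : walk n v w ->
  exists2 l, l <= n%:R & chain_length (vertex_point v) (vertex_point w) l.
Proof.
elim: n v => [v ->|n IH v [u vu /IH[l ln ul]]]; first by exists 0 => //; exact: chain_nil.
case: vu => [->|vu]; first by exists l => //; apply: le_trans ln _; rewrite ler_nat.
exists (`|0 - 1| + l); first by rewrite sub0r normrN normr1 -natr1 addrC lerD2r.
apply: (chain_cons vu _ _ _ _ ul); rewrite ?lexx ?ler01//=.
  by apply/funext => x; rewrite /segment_point !subr0 !mul0r !addr0.
by apply/funext => x; rewrite /segment_point !subr0 !subrr !mul0r !mul1r addr0 add0r.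
Qed.

Lemma path_dist_le (x z : pt) l : chain_length x z l -> path_dist x z <= l.
Proof.
by move=> xz; apply: ge_inf => //; exists 0 => k /chain_ge0.
Qed.

Lemma gdist_lip w v u : adj v u -> `|(gdist v w)%:R - (gdist u w)%:R : R| <= 1.
Proof.
move=> vu; have := gdist_step (or_intror vu); have := gdist_step (or_intror (adj_sym vu)).
have := gdist_triangle v u w; have := gdist_triangle u v w => h1 h2 h3 h4.
have {}h1 : (gdist u w <= 1 + gdist v w)%N by lia.
have {}h2 : (gdist v w <= 1 + gdist u w)%N by lia.
by move: h1 h2; rewrite -!(ler_nat R) !natrD ler_norml; lra.
Qed.

(** Up to an additive constant an arbitrary base point can be moved to a vertex. *)
Lemma path_dist_near (x : pt) : exists v, forall w,
  `|path_dist x (vertex_point w) - (gdist v w)%:R| <= 1.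
Proof.
have [v [u [t [vu t01 ex]]]] := baryP x; exists v => w.
have [l lw ch] := chain_walk (gdist_walk v w).
have [k k1 xw] : exists2 k, k <= (gdist v w)%:R + 1 & chain_length x (vertex_point w) k.
  case: vu => [vu|vu].
    have -> : x = vertex_point v; last by exists l => //; lra.
    have e : bary x = bary (vertex_point v).
      by rewrite ex -vu; apply/funext => y; rewrite /= /segment_point; ring.
    by case: (x) e ch => b bP /= e _; subst b; congr GraphPoint; exact: Prop_irrelevance.
  exists (`|t - 0| + l).
    by move: t01 => /andP[t0 t1]; rewrite subr0 ger0_norm//; lra.
  apply: (chain_cons vu t01 _ ex _ ch); first by rewrite lexx ler01.
  by apply/funext => y; rewrite /= /segment_point; ring.
have up := path_dist_le xw.
have low : (gdist v w)%:R - 1 <= path_dist x (vertex_point w).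
  apply: lb_le_inf; first by exists k.
  move=> j /(chain_lipschitz (p := fun v => (gdist v w)%:R) (gdist_lip w)).
  move=> /(_ v u t w w 0 ex erefl).
  have -> : gdist w w = 0%N by apply/eqP; rewrite -leqn0; apply: gdist_le.
  rewrite !mulr0 addr0 subr0 => h; apply: le_trans (le_trans (ler_norm _) h).
  have : `|(gdist v w)%:R - (gdist u w)%:R : R| <= 1.
    by case: vu => [->|/gdist_lip//]; rewrite subrr normr0.
  by rewrite ler_norml; move: t01 => /andP[t0 t1]; nra.
by rewrite ler_norml; lra.
Qed.

Lemma path_dist_vertex v w :
  path_dist (vertex_point v) (vertex_point w) = (gdist v w)%:R.
Proof.
have [l lw ch] := chain_walk (gdist_walk v w).
apply/eqP; rewrite eq_le (le_trans (path_dist_le ch) lw)/=.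
apply: lb_le_inf; first by exists l.
move=> j /(chain_lipschitz (p := fun v => (gdist v w)%:R) (gdist_lip w)).
move=> /(_ v v 0 w w 0 erefl erefl).
have -> : gdist w w = 0%N by apply/eqP; rewrite -leqn0; apply: gdist_le.
by rewrite !mulr0 !mul0r !addr0 subr0 subr0 mul1r => h; apply: le_trans (ler_norm _) h.
Qed.

End graph_distance.
(** * Moving inside a cell and along a track *)

Section geometry.
Variables (R : realType) (G : groupType) (P : tri_presentation G).
Notation K := (cover_complex R P).
Implicit Types (b : G -> R) (x y : K) (C : set K).

(** Travel straight from [x] to [y] and stop at the first point [q] where [b]
    reaches [m]. The last clause says that the set lies in the convex hull of
    [x] and [y]; applied to [- b'] it gives lower bounds. *)
Lemma cell_partial (c : cell P) x y b m : cell_set c x -> cell_set c y ->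
  extend b x <= m <= extend b y ->
  exists C q, [/\ connected C /\ C `<=` cell_set c, C x, C q /\ extend b q = m,
    (forall z, C z -> extend b z <= m) &
    forall b' r z, C z -> extend b' x <= r -> extend b' y <= r -> extend b' z <= r].
Proof.
move=> cx cy /andP[xm my].
have [p [cp p0 p1 pc pe]] := cell_path cx cy.
have [t0 t01 e] : exists2 t : R, 0 <= t <= 1 & (1 - t) * extend b x + t * extend b y = m.
  have [xy|xy] := eqVneq (extend b x) (extend b y).
    by exists 0; [rewrite lexx ler01|lra].
  have lt : 0 < extend b y - extend b x.
    by rewrite subr_gt0 lt_neqAle xy (le_trans xm my).
  exists ((m - extend b x) / (extend b y - extend b x)).
    by apply/andP; split; [rewrite divr_ge0//; lra|rewrite ler_pdivrMr// mul1r; lra].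
  by field; rewrite gt_eqF.
have sub : `[0, t0]%classic `<=` `[(0:R), 1]%classic.
  by move=> t; rewrite /= !in_itv /= => /andP[-> h]; apply: le_trans h _; case/andP: t01.
exists (p @` `[0, t0]), (p t0).
have I t : 0 <= t <= t0 -> (p @` `[0, t0]) (p t) by move=> h; exists t => //=; rewrite in_itv.
split.
- split; last by move=> _ [t /sub + <-]; rewrite /= in_itv; exact: pc.
  apply: connected_continuous_connected; first exact: segment_connected.
  exact: continuous_subspaceW sub cp.
- by rewrite -p0; apply: I; case/andP: t01 => -> _; rewrite lexx.
- by split; [apply: I; case/andP: t01 => -> _; rewrite lexx|rewrite pe].
- move=> _ [t tt <-]; have := sub _ tt; move: tt; rewrite /= !in_itv /= => /andP[h0 h1] h.
  rewrite pe// -e; nra.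
- move=> b' r _ [t /sub + <-]; rewrite /= in_itv /= => h xr yr.
  rewrite pe//; move: h => /andP[h0 h1]; nra.
Qed.

Lemma cell_hull (c : cell P) x y : cell_set c x -> cell_set c y ->
  exists C, [/\ connected C, C `<=` cell_set c, C x, C y &
    forall b r z, C z -> extend b x <= r -> extend b y <= r -> extend b z <= r].
Proof.
move=> cx cy; have [p [cp p0 p1 pc pe]] := cell_path cx cy.
exists (p @` `[0, 1]); split.
- by apply: connected_continuous_connected => //; exact: segment_connected.
- by move=> _ [t + <-]; rewrite /= in_itv; exact: pc.
- by exists 0 => //=; rewrite in_itv /= lexx ler01.
- by exists 1 => //=; rewrite in_itv /= lexx ler01.
- move=> b r _ [t + <-]; rewrite /= in_itv /= => h xr yr.
  rewrite pe//; move: h => /andP[h0 h1]; nra.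
Qed.

Variables (f : G -> R) (d : R).
Hypothesis tf : tame P f d.
Implicit Types (T : set K) (n : int) (g h : G).
Notation fx := (extend f : K -> R).

(** Boundary bumping, which holds in a track because it is a union of segments:
    go from cell to cell, starting at [p0], and stop as soon as [b] reaches [hi]
    or [lo]. *)
Lemma track_exit T (b : G -> R) (lo hi : R) p0 : tracks f T -> T p0 ->
  lo <= extend b p0 <= hi ->
  (forall y, T y -> lo <= extend b y <= hi) \/
  exists Z q, [/\ connected Z /\ Z `<=` T, Z p0, Z q,
    (forall z, Z z -> lo <= extend b z <= hi) & extend b q = hi \/ extend b q = lo].
Proof.
move=> tT Tp0 b0; have [n [cT _ lT mT]] := trackP tT.
have [?|no] := pselect (exists Z q, [/\ connected Z /\ Z `<=` T, Z p0, Z q,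
    (forall z, Z z -> lo <= extend b z <= hi) & extend b q = hi \/ extend b q = lo]); first by right.
left.
pose A := [set y | exists Z, [/\ connected Z, Z `<=` T, Z p0, Z y &
   forall z, Z z -> lo <= extend b z <= hi]].
suff TA : T `<=` A by move=> y /TA[Z [_ _ _ + h]]; exact: h.
apply: (track_ind tf tT Tp0).
  by exists [set p0]; split=> //; [exact: connected1|move=> _ ->|move=> _ ->].
move=> c x y cx cy Tx Ty [Z [cZ ZT Zp Zx Zb]].
have inT C : connected C -> C x ->
    (forall b' r z, C z -> extend b' x <= r -> extend b' y <= r -> extend b' z <= r) ->
    C `<=` T.
  move=> cC Cx hC; apply: (mT C x) => // z Cz; exists n; apply/eqP; rewrite eq_le.
  have ex := lT _ Tx; have ey := lT _ Ty.
  have := hC f _ z Cz; rewrite ex ey => /(_ _ (lexx _) (lexx _)) ->.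
  have := hC (fun g => - f g) (- (n%:~R + 2^-1)) z Cz.
  by rewrite !extendN ex ey lexx lerN2; exact.
have joint C : C x -> connected C -> connected (Z `|` C).
  by move=> Cx cC; apply: connectedU => //; exists x.
have /andP[lox hix] := Zb _ Zx.
have [yhi|yhi] := lerP (extend b y) hi; last first.
  exfalso; apply: no.
  have [C [q [[cC _] Cx [Cq eq] Chi hC]]] : exists C q, [/\ connected C /\ C `<=` cell_set c, C x,
    C q /\ extend b q = hi, (forall z, C z -> extend b z <= hi) &
    forall b' r z, C z -> extend b' x <= r -> extend b' y <= r -> extend b' z <= r].
    by apply: cell_partial => //; rewrite hix ltW.
  exists (Z `|` C), q; split; [split| | | |].
  - exact: joint.
  - by rewrite subUset; split=> //; exact: inT.
  - by left.
  - by right.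
  - move=> z [/Zb//|Cz]; rewrite (Chi _ Cz) andbT.
    have := hC (fun g => - b g) (- lo) z Cz; rewrite !extendN !lerN2; apply=> //.
    by apply: le_trans (ltW yhi); exact: le_trans hix.
  - by left.
have [ylo|ylo] := lerP lo (extend b y); last first.
  exfalso; apply: no.
  have [C [q [[cC _] Cx [Cq eq] Clo hC]]] : exists C q, [/\ connected C /\ C `<=` cell_set c, C x,
    C q /\ extend (fun g => - b g) q = - lo, (forall z, C z -> extend (fun g => - b g) z <= - lo) &
    forall b' r z, C z -> extend b' x <= r -> extend b' y <= r -> extend b' z <= r].
    by apply: cell_partial => //; rewrite !extendN !lerN2 lox ltW.
  exists (Z `|` C), q; split; [split| | | |].
  - exact: joint.
  - by rewrite subUset; split=> //; exact: inT.
  - by left.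
  - by right.
  - move=> z [/Zb//|Cz]; rewrite (hC b hi z Cz)// andbT.
    by have := Clo _ Cz; rewrite extendN lerN2.
  - by right; move: eq; rewrite extendN => /oppr_inj.
have [C [cC _ Cx Cy hC]] := cell_hull cx cy.
exists (Z `|` C); split; [exact: joint| |by left|by right|].
  by rewrite subUset; split=> //; exact: inT.
move=> z [/Zb//|Cz]; rewrite (hC b hi z Cz)// andbT.
by have := hC (fun g => - b g) (- lo) z Cz; rewrite !extendN !lerN2; exact.
Qed.

(** * Links between the vertices of X *)

Notation V := (X_vertex P f).
Notation adj := (@X_adj R G P f).
Notation step := (step adj).
Notation walk := (walk adj).
Implicit Types (v w u : V).

Definition vertex_set v : set K := translate v.1 @` (val v.2 : set K).

(** Adjacency or equality in [X], with the slab pulled back by [h] so that the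
    connecting set contains the translated tracks themselves. *)
Definition linked v w := exists (C : set K) h n, [/\ connected C, vertex_set v `<=` C,
  vertex_set w `<=` C & forall y, C y -> slab f n (translate h y)].

Lemma val_track v : tracks f (val v.2 : set K).
Proof. by have := valP v.2; rewrite inE. Qed.

Lemma vertex_set_connected v : connected (vertex_set v).
Proof.
have [n [cT _ _ _]] := trackP (val_track v).
apply: connected_continuous_connected => //.
by apply: continuous_subspaceT; exact: translate_continuous.
Qed.

Lemma vertex_set_nonempty v : vertex_set v !=set0.
Proof.
by have [n [_ [x Tx] _ _]] := trackP (val_track v); exists (translate v.1 x); exists x.
Qed.

Lemma linked_step v w : linked v w -> step v w.
Proof.
move=> [C [h [n [cC vC wC Cs]]]]; have [->|/eqP vw] := eqVneq v w; [by left|right].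
split=> //; have [x vx] := vertex_set_nonempty v.
exists h, n; exists (translate h x); first exact/Cs/vC.
have key u : vertex_set u `<=` C ->
    translate (h * u.1)%g @` (val u.2 : set K) `<=` connected_component (slab f n) (translate h x).
  move=> uC _ [t ut <-]; rewrite -translateM.
  exists (translate h @` C); last by exists (translate u.1 t) => //; apply: uC; exists t.
  split; first by exists x => //; exact: vC.
    by move=> _ [y /Cs + <-].
  apply: connected_continuous_connected => //.
  by apply: continuous_subspaceT; exact: translate_continuous.
by split; exact: key.
Qed.

Lemma adj_linked v w : adj v w -> linked v w.
Proof.
move=> [_ [h [n [x sx [vC wC]]]]].
exists (translate h^-1%g @` connected_component (slab f n) x), h, n.
have key u : translate (h * u.1)%g @` (val u.2 : set K) `<=` connected_component (slab f n) x ->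
   vertex_set u `<=` translate h^-1%g @` connected_component (slab f n) x.
  move=> uC _ [t ut <-]; exists (translate (h * u.1)%g t); first by apply: uC; exists t.
  by rewrite translateM mulKg.
split; [|exact: key|exact: key|].
  apply: connected_continuous_connected; first exact: component_connected.
  by apply: continuous_subspaceT; exact: translate_continuous.
move=> _ [y Cy <-]; rewrite translateM mulgV translate1.
exact: connected_component_sub Cy.
Qed.

Lemma X_adj_sym v w : adj v w -> adj w v.
Proof.
by move=> [vw [h [n [x sx [h1 h2]]]]]; split; [exact/nesym|exists h, n; exists x].
Qed.

Lemma vertex_set_close v x y : vertex_set v x -> vertex_set v y -> `|fx x - fx y| < 1 / 2.
Proof.
have [n [_ _ lT _]] := trackP (val_track v).
move=> [t /lT et <-] [s /lT es <-].
have := translate_close tf v.1 t; have := translate_close tf v.1 s.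
have := tame_d_itv tf; rewrite et es !ler_norml ltr_norml; lra.
Qed.

Lemma linked_refl v : linked v v.
Proof.
have [n [cT _ lT _]] := trackP (val_track v).
exists (vertex_set v), v.1^-1%g, n; split=> //; first exact: vertex_set_connected.
move=> _ [t /lT et <-]; rewrite translateM mulVg translate1.
by rewrite /slab /= et; lra.
Qed.

(** A slab has width 2, and translating by [h] changes differences of heights by
    at most [2 d]. *)
Lemma linked_close v w x y : linked v w -> vertex_set v x -> vertex_set w y -> `|fx x - fx y| <= 3.
Proof.
move=> [C [h [n [_ vC wC Cs]]]] /vC/Cs + /wC/Cs; rewrite /slab /= => sx sy.
have := translate_close tf h x; have := translate_close tf h y.
have := tame_d_itv tf; rewrite !ler_norml; lra.
Qed.

Definition track_vertex T (tT : tracks f T) : V := (1%g, SigSub (mem_set tT)).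

Lemma vertex_set_track_vertex T (tT : tracks f T) : vertex_set (track_vertex tT) = T.
Proof.
rewrite /vertex_set /=; apply/seteqP; split=> [_ [x Tx <-]|x Tx].
  by rewrite translate1.
by exists x => //; rewrite translate1.
Qed.

End geometry.
(** * Bottlenecks and connectedness of X *)

Section bottleneck.
Variables (R : realType) (G : groupType) (P : tri_presentation G).
Notation K := (cover_complex R P).
Notation letter := (generators P * bool)%type.
Notation lval := (letter_val (@gen G P)).
Notation wval := (word_val (@gen G P)).
Variables (f : G -> R) (d : R).
Hypothesis tf : tame P f d.
Implicit Types (x y : K) (C : set K) (T : set K) (n : int) (g h : G).
Notation fx := (extend f : K -> R).
Notation H := (@half_integer_levels R G P f).
Notation V := (X_vertex P f).
Notation adj := (@X_adj R G P f).
Notation step := (step adj).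
Notation walk := (walk adj).
Implicit Types (v w u : V).

(** If the translate [h T] stays in the slab, then [T] can be added to [C].
    Otherwise [h T] contains a point [h q] on the boundary of the slab that is
    joined to [h p0] inside the slab. The track through [h q] is linked to [v]
    inside the slab; as [h T] has width less than [1/2], it is also linked to
    [h T] inside the next slab. *)
Lemma near_track v C h n T (tT : tracks f T) : connected C -> vertex_set v `<=` C ->
  (forall y, C y -> slab f n (translate h y)) -> C `&` T !=set0 ->
  walk 2 v (track_vertex tT).
Proof.
move=> cC vC Cs [p0 [Cp0 Tp0]]; have [m [cT _ lT mT]] := trackP tT.
have s0 := Cs _ Cp0; rewrite /slab /= in s0.
have b0 : n%:~R - 3 / 2 <= extend (fun g => f (h * g)%g) p0 <= n%:~R + 2^-1.
  by rewrite -extend_translate.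
have [Ts|[Z [q [[cZ ZT] Zp0 Zq Zs qe]]]] := track_exit tf tT Tp0 b0.
  exists (track_vertex tT); last by exists (track_vertex tT) => //; left.
  apply: linked_step; exists (C `|` T), h, n; rewrite vertex_set_track_vertex; split.
  - by apply: connectedU => //; exists p0.
  - by move=> x /vC; left.
  - by move=> x; right.
  - by move=> y [/Cs//|/Ts]; rewrite -extend_translate.
(* The end of the slab reached by [h T] is the half-integral level [k + 1/2]. *)
have [k [lk ks]] : exists k : int, fx (translate h q) = k%:~R + 2^-1 /\
    (k%:~R + 2^-1 = n%:~R + 2^-1 :> R \/ k%:~R + 2^-1 = n%:~R - 3 / 2 :> R).
  rewrite extend_translate; case: qe => ->; [exists n|exists (n - 2)]; split=> //; [by left| |right];
  by rewrite rmorphB /= ; lra.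
pose q' := translate h q; have Hq : H q' by exists k.
pose T' := connected_component H q'.
have tT' : tracks f T' by exists q'.
have T'q : T' q' by exact: connected_component_refl.
have lT' x : T' x -> fx x = k%:~R + 2^-1.
  move=> Tx; rewrite -lk.
  exact: (half_level_eq (@component_connected _ H q') (@connected_component_sub _ H q') Tx T'q).
(* The intermediate vertex: [h^-1] times the track through [h q]. *)
pose u : V := (h^-1%g, SigSub (mem_set tT')).
have uq : vertex_set u q by exists q' => //; rewrite translateM mulVg translate1.
have uT' y : vertex_set u y -> fx (translate h y) = k%:~R + 2^-1.
  by move=> [t Tt <-]; rewrite translateM mulgV translate1; exact: lT'.
have Tq : T q by exact: ZT.
have cu : connected (vertex_set u) by exact: vertex_set_connected.
exists u.
  apply: linked_step; exists ((C `|` Z) `|` vertex_set u), h, n; split.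
  - apply: connectedU => //; first by exists q; split; [right|].
    by apply: connectedU => //; exists p0.
  - by move=> x /vC; left; left.
  - by move=> x; right.
  - move=> y [[/Cs//|/Zs]|/uT' e]; rewrite /slab /=; first by rewrite -extend_translate.
    rewrite e; case: ks => ->; lra.
exists (track_vertex tT) => //.
apply: linked_step; exists (vertex_set u `|` T), h, (k + 1); rewrite vertex_set_track_vertex; split.
- by apply: connectedU => //; exists q.
- by move=> x; left.
- by move=> x; right.
- have dq := translate_close tf h q; have e := lT _ Tq.
  move=> y; rewrite /slab /= rmorphD /= => -[/uT' ->|Ty]; first by lra.
  have dy := translate_close tf h y; have ey := lT _ Ty; have dd := tame_d_itv tf.
  move: dq dy; rewrite !ler_norml; lra.
Qed.

Lemma walk_level (n : nat) v w x y : walk n v w -> vertex_set v x -> vertex_set w y ->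
  `|fx x - fx y| <= 3 * n%:R + 1 / 2.
Proof.
elim: n v x => [v x /= <- vx vy|n IH v x /= [u vu uw] vx wy].
  by rewrite mulr0 add0r ltW// (vertex_set_close tf vx vy).
have [z uz] := vertex_set_nonempty u.
have := IH _ _ uw uz wy; rewrite -natr1.
have : `|fx x - fx z| <= 3.
  case: vu => [e|/adj_linked l]; last exact: (linked_close tf l).
  by rewrite -e in uz; have := vertex_set_close tf vx uz; lra.
rewrite !ler_norml; lra.
Qed.

Lemma sign_cross (a : G -> R) C x y : connected C -> C x -> C y ->
  extend a x < 0 -> 0 < extend a y -> exists2 z, C z & extend a z = 0.
Proof. by move=> cC Cx Cy ax ay; apply: connected_between cC Cx Cy _; rewrite !ltW. Qed.

(** The connecting sets along the walk join [x] to [y], so one of them contains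
    a zero of [a]. *)
Lemma walk_bottleneck T (tT : tracks f T) (a : G -> R) (n : nat) v w x y :
  (forall z, extend a z = 0 -> T z) -> walk n v w -> vertex_set v x -> vertex_set w y ->
  extend a x < 0 -> 0 < extend a y ->
  exists i j u, [/\ (i + j <= n)%N, walk i v u, walk j u w & walk 2 u (track_vertex tT)].
Proof.
move=> aT; elim: n v x => [v x /= <- vx vy ax ay|n IH v x /= [u vu uw] vx wy ax ay].
  have [z vz /aT Tz] := sign_cross (@vertex_set_connected R G P f v) vx vy ax ay.
  have [C [h [n [cC vC _ Cs]]]] := linked_refl v.
  exists 0%N, 0%N, v; split=> //; apply: (near_track tT cC vC Cs).
  by exists z; split=> //; exact: vC.
have [C [h [m [cC vC uC Cs]]]] : linked v u by case: vu => [<-|/adj_linked//]; exact: linked_refl.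
have [z uz] := vertex_set_nonempty u.
have [zneg|zpos] := ltP (extend a z) 0.
  have [i [j [u' [ijn iu ju u'T]]]] := IH _ _ uw uz wy zneg ay.
  by exists i.+1, j, u'; split=> //; exists u.
have [z' Cz' /aT Tz'] : exists2 z', C z' & extend a z' = 0.
  by apply: connected_between cC (vC _ vx) (uC _ uz) _; rewrite ltW.
exists 0%N, n.+1, v; split=> //; first by exists u.
by apply: (near_track tT cC vC Cs); exists z'.
Qed.

Lemma extend_between x y C (b : G -> R) lo hi :
  (forall b r z, C z -> extend b x <= r -> extend b y <= r -> extend b z <= r) ->
  lo <= extend b x <= hi -> lo <= extend b y <= hi ->
  forall z, C z -> lo <= extend b z <= hi.
Proof.
move=> hC /andP[x1 x2] /andP[y1 y2] z Cz; rewrite (hC b hi z Cz)// andbT.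
have := hC (fun g => - b g) (- lo) z Cz; rewrite !extendN !lerN2; exact.
Qed.

(** Each right multiplication by a generator with [d < f s] raises [f] by at
    least [f s - d], which is positive, so that the level is reached without
    ever going down. *)
Lemma climb n g : n%:~R - 2^-1 < f g < n%:~R + 2^-1 ->
  exists T C, [/\ tracks f T, connected C, C (Vertex g), T `<=` C &
    forall y, C y -> n%:~R - 2^-1 <= fx y <= n%:~R + 2^-1].
Proof.
have [s sd] := tame_climb tf.
have up g' : f g' + (f (gen s) - d) <= f (g' * gen s)%g.
  by have := tame_defect tf g' (gen s); rewrite ler_norml; lra.
have [M hM] : exists M : nat, 1 < (f (gen s) - d) * M%:R.
  have d0 : 0 < f (gen s) - d by lra.
  exists (Num.trunc (1 / (f (gen s) - d))).+1.
  rewrite mulrC -ltr_pdivrMr//; have := truncnS_gt (1 / (f (gen s) - d)); exact.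
move=> gn; have : n%:~R + 2^-1 - f g < (f (gen s) - d) * M%:R by lra.
elim: M {hM} g gn => [|M IH] g gn; first by rewrite mulr0; lra.
rewrite -[M.+1%:R]natr1 => hM.
pose c : cell P := inl (g, s).
have cg : cell_set c (Vertex g : K) by apply: (@cell_vertex R _ _ c g); left.
have cgs : cell_set c (Vertex (g * gen s)%g : K).
  by apply: (@cell_vertex R _ _ c (g * gen s)%g); right.
have upg := up g.
have [lt|ge] := ltP (f (g * gen s)%g) (n%:~R + 2^-1).
  have [| |T [C [tT cC Cgs TC Cb]]] := IH (g * gen s)%g; [lra|lra|].
  have [C' [cC' _ C'g C'gs hC']] := cell_hull cg cgs.
  exists T, (C `|` C'); split=> //.
  - by apply: connectedU => //; exists (Vertex (g * gen s)%g).
  - by right.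
  - by move=> x /TC; left.
  - move=> y [/Cb//|]; apply: (extend_between hC' _ _) => /=; lra.
have gm : extend f (Vertex g : K) <= n%:~R + 2^-1 <= extend f (Vertex (g * gen s)%g : K).
  by rewrite /=; lra.
have [C [q [[cC _] Cg [Cq eq] Cn hC]]] := cell_partial cg cgs gm.
have Hq : H q by exists n.
have T'q : connected_component H q q by exact: connected_component_refl.
exists (connected_component H q), (C `|` connected_component H q); split.
- by exists q.
- by apply: connectedU => //; [exists q|exact: component_connected].
- by left.
- by right.
- move=> y [Cy|Ty].
    rewrite Cn// andbT; have := hC (fun g => - f g) (- (n%:~R - 2^-1)) y Cy.
    by rewrite !extendN !lerN2 /=; apply; have := tame_d_itv tf; lra.
  rewrite (half_level_eq (@component_connected _ H q) (@connected_component_sub _ H q) Ty T'q) eq.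
  by rewrite lexx andbT; lra.
Qed.

Lemma near_int g : exists n : int, n%:~R - 2^-1 < f g < n%:~R + 2^-1.
Proof.
exists (Num.floor (f g + 2^-1)).
have /andP[l1 l2] := floor_itv (f g + 2^-1).
have := @tame_half _ _ _ _ _ tf g (Num.floor (f g + 2^-1) - 1); rewrite rmorphB /= => h.
rewrite rmorphD /= in l2.
apply/andP; split; last by lra.
by rewrite lt_neqAle; apply/andP; split; [apply/eqP => e; apply: h; lra|lra].
Qed.

(** The tracks reached by climbing from [g] to the next level. There may be
    several of them, all at distance at most 1 from one another. *)
Definition climbs g v := exists T (tT : tracks f T) C (n : int),
  [/\ v = track_vertex tT, n%:~R - 2^-1 < f g < n%:~R + 2^-1, connected C, C (Vertex g) /\ T `<=` C &
    forall y, C y -> n%:~R - 2^-1 <= fx y <= n%:~R + 2^-1].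

Lemma climbs_ex g : exists v, climbs g v.
Proof.
have [n gn] := near_int g; have [T [C [tT cC Cg TC Cb]]] := climb gn.
by exists (track_vertex tT), T, tT, C, n.
Qed.

(** The two levels differ by at most 1, so the two climbs and the cell between
    them fit in one slab. *)
Lemma climbs_step (c : cell P) g h v w : cell_vertices c g -> cell_vertices c h ->
  climbs g v -> climbs h w -> step v w.
Proof.
move=> cg ch; have {}cg := @cell_vertex R _ _ _ _ cg; have {}ch := @cell_vertex R _ _ _ _ ch.
have fgh := cell_close tf cg ch.
have sl C k : (forall y, C y -> k%:~R - 3 / 2 <= fx y <= k%:~R + 2^-1) ->
    forall y, C y -> slab f k (translate 1%g y).
  by move=> h' y /h'; rewrite translate1.
move=> [T [tT [C [n [-> gn cC [Cg TC] Cb]]]]] [T' [tT' [C' [n' [-> hn' cC' [C'h TC'] Cb']]]]].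
have [D [cD _ Dg Dh hD]] := cell_hull cg ch.
have cCDC : connected (C `|` D `|` C').
  apply: connectedU => //; first by exists (Vertex h); split; [right|].
  by apply: connectedU => //; exists (Vertex g).
have le : `|n%:~R - n'%:~R : R| < 2.
  by move: fgh => /=; rewrite !ltr_norml; lra.
have [k] : exists k : int, (n <= k <= n + 1) && (n' <= k <= n' + 1).
  apply: common_int; move: le; rewrite -intrB -intr_norm.
  by rewrite (_ : 2 = 2%:~R :> R)// ltr_int.
have kb (x : int) : (x <= k <= x + 1)%R -> (x%:~R : R) <= (k%:~R : R) <= x%:~R + 1.
  by move=> /andP[x1 x2]; rewrite ler_int x1 /= -[1]/(1%:~R) -intrD ler_int.
move=> /andP[/kb kn /kb kn'].
apply: linked_step; exists (C `|` D `|` C'), 1%g, k; rewrite !vertex_set_track_vertex; split=> //.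
- by move=> x /TC; left; left.
- by move=> x /TC'; right.
- apply: sl => y [[/Cb|]|/Cb']; [lra| |lra].
  by apply: (extend_between hD _ _) => /=; lra.
Qed.

Lemma climbs_word (w : seq letter) g u v : climbs g u -> climbs (g * wval w)%g v ->
  exists n : nat, walk n u v.
Proof.
elim: w g u => [|l w IH] g u gu.
  rewrite /word_val big_nil mulg1 => gv; exists 1%N; exists v => //.
  have [s _] := tame_climb tf.
  by apply: (@climbs_step (inl (g, s)) g g) => //; left.
rewrite /word_val big_cons mulgA => hv.
have [u' gu'] := climbs_ex (g * lval l)%g.
have [n uv] := IH _ _ gu' hv.
exists n.+1; exists u' => //.
pose c : cell P := inl (if l.2 then g else (g * (gen l.1)^-1)%g, l.1).
apply: (@climbs_step c g (g * lval l)%g) => //; rewrite /c; case: (l) => s [] /=; rewrite /letter_val /= ?mulgVK;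
  by [left|right].
Qed.

(** The translated track of [v] has width less than [1/2]; together with a
    climb from a vertex near it, it fits in the slab below the level of the
    climb, or in the next one if it passes above this level. *)
Lemma climbs_near v : exists g u, climbs g u /\ step v u.
Proof.
have [x vx] := vertex_set_nonempty v; have [s0 _] := tame_climb tf.
have [c cx] := cell_cover s0 x.
have [g /(cell_carrier cx)/(@cell_vertex R) cg _] := carrier_le f x.
have [u gu] := climbs_ex g; exists g, u; split=> //.
have [T [tT [C [n [-> gn cC [Cg TC] Cb]]]]] := gu.
have [D [cD _ Dx Dg hD]] := cell_hull cx cg.
have fxg := cell_close tf cx cg; rewrite /= ltr_norml in fxg.
have cvDC : connected (vertex_set v `|` D `|` C).
  apply: connectedU => //; first by exists (Vertex g); split; [right|].
  by apply: connectedU => //; [exists x|exact: vertex_set_connected].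
have fin k : (forall y, (vertex_set v `|` D `|` C) y -> k%:~R - 3 / 2 <= fx y <= k%:~R + 2^-1) ->
    step v (track_vertex tT).
  move=> h; apply: linked_step; exists (vertex_set v `|` D `|` C), 1%g, k; rewrite vertex_set_track_vertex; split=> //.
  - by move=> z; left; left.
  - by move=> z /TC; right.
  - by move=> y /h; rewrite translate1.
(* The slab depends on whether the translated track of [v] passes above the level of the climb. *)
have [[y0 [vy0 hy0]]|no] := pselect (exists y, vertex_set v y /\ n%:~R + 2^-1 < fx y).
  apply: (fin (n + 1)) => y; rewrite rmorphD /= => -[[vy|Dy]|/Cb]; last by lra.
    have := vertex_set_close tf vy0 vy; have := vertex_set_close tf vx vy; rewrite !ltr_norml; lra.
  have := vertex_set_close tf vy0 vx; rewrite ltr_norml => h0.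
  by apply: (extend_between hD _ _ Dy) => /=; lra.
have up y : vertex_set v y -> fx y <= n%:~R + 2^-1.
  by move=> vy; rewrite leNgt; apply/negP => h; apply: no; exists y.
apply: (fin n) => y [[vy|Dy]|/Cb]; last by lra.
  have := up _ vy; have := vertex_set_close tf vx vy; rewrite !ltr_norml; lra.
have := up _ vx => h0.
by apply: (extend_between hD _ _ Dy) => /=; lra.
Qed.

(** An infimum over no paths would be 0, so lower bounds on [path_dist] rely on
    connectedness. *)
Lemma X_connected v w : exists n : nat, walk n v w.
Proof.
have [g [u [gu vu]]] := climbs_near v; have [h [u' [hu' wu']]] := climbs_near w.
have [l el] := gen_surj P (g^-1 * h)%g.
have hu'' : climbs (g * wval l)%g u' by rewrite el mulVKg.
have [n un] := climbs_word gu hu''.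
have vn : walk n.+1 v u' by exists u.
have uw : walk 1 u' w by exists w => //; apply: step_sym wu'; exact: X_adj_sym.
by exists (n.+1 + 1)%N; exact: walk_cat vn uw.
Qed.

(** A track whose level exceeds [B] in absolute value cannot separate [x] from
    [y]. *)
Lemma bounded_connection x y : exists B C, [/\ connected C, C x, C y &
  forall z, C z -> `|fx z| <= B].
Proof.
have [s0 _] := tame_climb tf.
pose rel x y := exists B C, [/\ connected C, C x, C y & forall z, C z -> `|fx z| <= B].
have rsym x' y' : rel x' y' -> rel y' x' by move=> [B [C [*]]]; exists B, C.
have rtrans x' y' z' : rel x' y' -> rel y' z' -> rel x' z'.
  move=> [B [C [cC Cx Cy CB]]] [B' [C' [cC' Cx' Cy' CB']]].
  exists (Num.max B B'), (C `|` C'); split; [|by left|by right|].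
    by apply: connectedU => //; exists y'.
  by move=> z [/CB|/CB'] h; rewrite le_max h ?orbT.
have rcell c x' y' : cell_set c x' -> cell_set c y' -> rel x' y'.
  move=> cx cy; have [C [cC Cc Cx Cy _]] := cell_hull cx cy.
  exists (`|fx x'| + 1 / 4), C; split=> // z /Cc cz.
  have := cell_close tf cz cx; have := ler_normB (fx z - fx x') (- fx x').
  by rewrite normrN opprK subrK; lra.
have rvert x' : exists g, rel x' (Vertex g).
  have [c cx] := cell_cover s0 x'.
  have [g /(cell_carrier cx)/(@cell_vertex R) cg _] := carrier_le f x'.
  by exists g; exact: rcell cx cg.
have rword (w : seq letter) g : rel (Vertex g) (Vertex (g * wval w)%g).
  elim: w g => [|l w IH] g.
    rewrite /word_val big_nil mulg1; apply: (rcell (inl (g, s0))); by apply: cell_vertex; left.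
  rewrite /word_val big_cons mulgA; apply: rtrans (IH _).
  have h0 := @letter_map_edge R G P g l 0; have h1 := @letter_map_edge R G P g l 1.
  rewrite letter_map0 in h0; rewrite letter_map1 in h1.
  by apply: rcell (h0 _) (h1 _); rewrite ?lexx ler01.
have [g xg] := rvert x; have [h yh] := rvert y.
have [w ew] := gen_surj P (g^-1 * h)%g.
have gh := rword w g; rewrite ew mulVKg in gh.
exact: (rtrans _ _ _ xg (rtrans _ _ _ gh (rsym _ _ yh))).
Qed.

End bottleneck.
(** * Paths in the Cayley graph that follow a track *)

Lemma path_concat (R : realType) (U : topologicalType) (a b : R -> U) :
  {within `[0, 1], continuous a} -> {within `[0, 1], continuous b} -> a 1 = b 0 ->
  exists c : R -> U, [/\ {within `[0, 1], continuous c}, c 0 = a 0, c 1 = b 1 &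
    forall t, 0 <= t <= 1 -> exists2 u, 0 <= u <= 1 & c t = a u \/ c t = b u].
Proof.
move=> ca cb ab.
pose c t := if t <= 2^-1 then a (2 * t) else b (2 * t - 1).
have cl : {within `[0, 2^-1], continuous c}.
  apply: (subspace_eq_continuous (f := (a \o (fun t => 2 * t)) : subspace `[0, 2^-1] -> U)).
    by move=> t; rewrite inE /= in_itv /= => /andP[_ t2]; rewrite -[RHS]/(c t) /c t2.
  have c2 : {within `[0, 2^-1], continuous (fun t : R => 2 * t)}.
    apply: continuous_subspaceT => t; apply: cvgMl_tmp; exact: cvg_id.
  have s2 : (fun t : R => 2 * t) @` `[0, 2^-1] `<=` `[0, 1].
    by move=> _ [t + <-]; rewrite /= !in_itv /=; lra.
  exact: (within_comp c2 s2 ca).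
have cr : {within `[2^-1, 1], continuous c}.
  apply: (subspace_eq_continuous (f := (b \o (fun t => 2 * t - 1)) : subspace `[2^-1, 1] -> U)).
    move=> t; rewrite inE /= in_itv /= => /andP[t2 _]; rewrite -[RHS]/(c t) /c.
    case: ifPn => [t2'|//]; have -> : t = 2^-1 by apply/eqP; rewrite eq_le t2 t2'.
    by rewrite mulfV// subrr ab.
  have c2 : {within `[2^-1, 1], continuous (fun t : R => 2 * t - 1)}.
    apply: continuous_subspaceT => t; apply: cvgB; last exact: cvg_cst.
    by apply: cvgMl_tmp; exact: cvg_id.
  have s2 : (fun t : R => 2 * t - 1) @` `[2^-1, 1] `<=` `[0, 1].
    by move=> _ [t + <-]; rewrite /= !in_itv /=; lra.
  exact: (within_comp c2 s2 cb).
exists c; split.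
- have -> : `[(0:R), 1]%classic = `[0, 2^-1] `|` `[2^-1, 1].
    apply/seteqP; split=> t; rewrite /= !in_itv /=; last by case; lra.
    by move=> /andP[-> ->]; rewrite andbT; apply/orP; exact: le_total.
  by apply: withinU_continuous => //; exact: interval_closed.
- by rewrite /c invr_ge0 ler0n mulr0.
- by rewrite /c ifF ?mulr1 ?addrK//; apply/negbTE; rewrite -ltNge; lra.
- move=> t t01; rewrite /c; case: ifPn => [|/negbTE] h.
    by exists (2 * t); [lra|left].
  have {}h : 2^-1 < t by rewrite ltNge h.
  by exists (2 * t - 1); [lra|right].
Qed.

Section track_paths.
Variables (R : realType) (G : groupType) (P : tri_presentation G).
Notation K := (cover_complex R P).
Variables (f : G -> R) (d : R).
Hypothesis tf : tame P f d.
Implicit Types (x y : K) (C : set K) (T : set K) (n : int) (g h : G).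
Notation fx := (extend f : K -> R).

(** The paths required by the definition of [E(f)]; on a cell that meets a level
    [f] stays within [1/4] of it. *)
Definition graph_path (r : R) x y := exists p : R -> K,
  [/\ {within `[0, 1], continuous p}, p 0 = x, p 1 = y &
    forall t, 0 <= t <= 1 -> @cayley_graph R G P (p t) /\ `|fx (p t) - r| <= 1 / 4].

Lemma graph_path_trans r x y z : graph_path r x y -> graph_path r y z -> graph_path r x z.
Proof.
move=> [p [cp p0 p1 pb]] [q [cq q0 q1 qb]].
have [|s [cs s0 s1 sb]] := path_concat cp cq; first by rewrite p1 q0.
exists s; split=> //; [by rewrite s0|by rewrite s1|].
by move=> t /sb[u u01 [->|->]]; [exact: pb|exact: qb].
Qed.

Lemma edge_cayley e : cell_set (inl e) `<=` @cayley_graph R G P.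
Proof.
case: e => g s _ [t _ <-]; rewrite /edge_map; case: insub => //=.
by case: ifP.
Qed.

Lemma graph_path_edge e c r z x y : cell_set (inl e) x -> cell_set (inl e) y ->
  (forall w : K, cell_set (inl e) w -> cell_set c w) -> cell_set c z -> fx z = r ->
  graph_path r x y.
Proof.
move=> ex ey ec cz zr; have [p [cp p0 p1 pe _]] := cell_path ex ey.
exists p; split=> // t t01; split; first exact/edge_cayley/pe.
by rewrite -zr ltW// (cell_close tf (ec _ (pe _ t01)) cz).
Qed.

(** A track runs from cell to cell; replacing its segments by edges of the cells
    gives a path in the graph near the same level. *)
Lemma track_graph_path T n x y : tracks f T -> (forall z, T z -> fx z = n%:~R + 2^-1) ->
  T x -> T y -> @cayley_graph R G P x -> @cayley_graph R G P y ->
  graph_path (n%:~R + 2^-1) x y.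
Proof.
move=> tT Tn Tx Ty.
have edge z : T z -> @cayley_graph R G P z ->
    exists e, cell_set (inl e) z /\ carrier z = cell_vertices (inl e).
  move=> /Tn; case: z => [g /(tame_half tf)//|g s t _ _|//].
  exists (g, s); split=> //; exists (val t).
    by have /andP[t0 t1] := valP t; rewrite /= in_itv /= !ltW.
  by rewrite /edge_map valK.
move=> /(edge _ Tx)[ex [xe xc]] /(edge _ Ty)[ey [ye yc]].
pose A := [set z : K | exists2 v, carrier z v & graph_path (n%:~R + 2^-1) x (Vertex v)].
have : A y.
  apply: (track_ind tf tT Tx _ _ Ty).
    exists ex.1; first by rewrite xc; left.
    apply: (graph_path_edge (c := inl ex) (z := x) xe) => //; last exact: Tn.
    by apply: cell_vertex; left.
  move=> c z z' cz cz' Tz Tz' [v /(cell_carrier cz) cv xv].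
  have [w zw _] := carrier_le f z'; exists w => //.
  have [<-//|[l -> lc]] := cell_vertices_adj R cv (cell_carrier cz' zw).
  apply: graph_path_trans xv _.
  exists (letter_map v l); split; [|exact: letter_map0|exact: letter_map1|].
    have le t := @letter_map_edge R G P v l t.
    case: (l) => s []; rewrite /letter_map /=; first exact: edge_map_continuous.
    have c2 : {within `[0, 1], continuous (fun t : R => 1 - t)}.
      by apply: continuous_subspaceT => t; apply: cvgB; [exact: cvg_cst|exact: cvg_id].
    have s2 : (fun t : R => 1 - t) @` `[0, 1] `<=` `[0, 1].
      by move=> _ [t + <-]; rewrite /= !in_itv /=; lra.
    exact: (within_comp c2 s2 (@edge_map_continuous R G P _ s)).
  move=> t t01; split; first exact/edge_cayley/letter_map_edge.
  by rewrite -(Tn _ Tz) ltW// (cell_close tf (lc _ t01) cz).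
move=> [v]; rewrite yc => yv xv; apply: graph_path_trans xv _.
apply: (graph_path_edge (e := ey) (c := inl ey) (z := y)) => //; last exact: Tn.
exact: cell_vertex.
Qed.

End track_paths.
(** * Rays and the tracks that they cross *)

Section rays.
Variables (R : realType) (G : groupType) (P : tri_presentation G).
Notation K := (cover_complex R P).
Variables (f : G -> R) (d : R).
Hypothesis tf : tame P f d.
Implicit Types (x y : K) (C : set K) (T : set K) (n : int) (g h : G) (k : nat).
Implicit Types (phi psi : ray R P) (e : R).
Notation fx := (extend f : K -> R).
Notation V := (X_vertex P f).
Notation adj := (@X_adj R G P f).
Notation walk := (walk adj).

(** The sign of [a] tells the two sides of [T]. *)
Definition track_cut T n (a : G -> R) := [/\ tracks f T,
  forall x, T x -> fx x = n%:~R + 2^-1 & forall x, extend a x = 0 -> T x].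

Lemma track_cutN T n a : track_cut T n a -> track_cut T n (fun g => - a g).
Proof.
move=> [tT Tn a0]; split=> // x; rewrite extendN => /eqP; rewrite oppr_eq0 => /eqP.
exact: a0.
Qed.

Lemma pos_connected (a : G -> R) C x y : connected C ->
  (forall z, C z -> extend a z <> 0) -> C x -> C y -> 0 < extend a x -> 0 < extend a y.
Proof.
move=> cC C0 Cx Cy ax; rewrite ltNge; apply/negP => ay.
have [z Cz /(C0 _ Cz)//] : exists2 z, C z & extend a z = 0.
by apply: connected_between cC Cy Cx _; rewrite ay ltW.
Qed.

Lemma track_cut_pos T n a C x y : track_cut T n a -> connected C ->
  (forall z, C z -> fx z <> n%:~R + 2^-1) -> C x -> C y ->
  0 < extend a x -> 0 < extend a y.
Proof. by move=> [_ Tn a0] cC Cn; apply: pos_connected => // z Cz /a0/Tn; exact: Cn. Qed.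

Lemma track_cut_neg T n a C x y : track_cut T n a -> connected C ->
  (forall z, C z -> fx z <> n%:~R + 2^-1) -> C x -> C y ->
  extend a x < 0 -> extend a y < 0.
Proof.
move=> /track_cutN cT cC Cn Cx Cy; have := track_cut_pos cT cC Cn Cx Cy.
by rewrite !extendN !oppr_gt0.
Qed.

Lemma ray_connected phi s t : 0 <= s -> connected (phi @` `[s, t]).
Proof.
move=> s0; apply: connected_continuous_connected; first exact: segment_connected.
apply: continuous_subspaceW (@ray_continuous R G P phi).
by move=> u; rewrite /= !in_itv /= andbT => /andP[su _]; exact: le_trans su.
Qed.

Lemma ray_bounded phi t : 0 <= t -> exists B, forall s, 0 <= s <= t -> `|fx (phi s)| <= B.
Proof.
move=> t0; have cf : {within `[0, t], continuous (fx \o phi)}.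
  apply: continuous_within_comp (@extend_continuous R G P f).
  apply: continuous_subspaceW (@ray_continuous R G P phi).
  by move=> u; rewrite /= !in_itv /= andbT => /andP[].
have [M _ hM] := EVT_max t0 cf; have [m _ hm] := EVT_min t0 cf.
exists (`|fx (phi M)| + `|fx (phi m)|) => s st.
have sI : s \in `[0, t] by rewrite in_itv.
have := hM _ sI; have := hm _ sI; rewrite /= => h1 h2.
have := ler_norm (fx (phi M)); have := ler_norm (- fx (phi m)); rewrite normrN => h3 h4.
rewrite ler_norml.
have := normr_ge0 (fx (phi M)); have := normr_ge0 (fx (phi m)); lra.
Qed.

Definition escapes phi e := forall B, exists2 S, 0 <= S &
  forall t, S <= t -> B < e * fx (phi t).

Definition is_sign e := e = 1 \/ e = -1.

Lemma escapes_norm phi e : is_sign e -> escapes phi e -> forall B, exists2 S, 0 <= S &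
  forall t, S <= t -> B < `|fx (phi t)|.
Proof.
move=> se ephi B; have [S S0 h] := ephi B; exists S => // t /h.
move=> h'; apply: lt_le_trans h' _.
case: se => ->; first by rewrite mul1r ler_norm.
by rewrite mulN1r -normrN ler_norm.
Qed.

Definition tail_pos phi (a : G -> R) := exists2 S, 0 <= S &
  forall t, S <= t -> 0 < extend a (phi t).

(** Beyond some time the ray avoids the level of [T]. *)
Lemma tail_side phi e T n a : is_sign e -> escapes phi e -> track_cut T n a ->
  tail_pos phi a \/ tail_pos phi (fun g => - a g).
Proof.
move=> se ephi cT; have [S S0 h] := escapes_norm se ephi `|n%:~R + 2^-1|.
have C0 t z : (phi @` `[S, t]) z -> fx z <> n%:~R + 2^-1.
  by move=> [u + <-] e'; rewrite /= in_itv /= => /andP[/h]; rewrite e' ltxx.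
have I t : S <= t -> (phi @` `[S, t]) (phi S) /\ (phi @` `[S, t]) (phi t).
  by move=> St; split; [exists S|exists t] => //=; rewrite in_itv /= lexx St.
have [neg|pos|z] := ltrgtP (extend a (phi S)) 0.
- right; exists S => // t St; have [iS it] := I _ St.
  rewrite extendN oppr_gt0; exact: track_cut_neg cT (@ray_connected phi _ t S0) (@C0 t) iS it neg.
- left; exists S => // t St; have [iS it] := I _ St.
  exact: track_cut_pos cT (@ray_connected phi _ t S0) (@C0 t) iS it pos.
- have [_ Tn a0] := cT; have := C0 S (phi S); case => //.
    by have [] := I _ (lexx S).
  exact/Tn/a0.
Qed.

Lemma tail_pos_contra phi a : tail_pos phi a -> tail_pos phi (fun g => - a g) -> False.
Proof.
move=> [S S0 h] [S' S0' h'].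
have := h (Num.max S S'); have := h' (Num.max S S'); rewrite !le_max !lexx orbT.
by rewrite extendN => /(_ isT) ? /(_ isT) ?; lra.
Qed.

(** Until time [S] the ray stays in a bounded connected set containing the
    vertex [1], which no far track can meet. It must therefore cross [T] later. *)
Lemma ray_meets phi (S : R) : 0 <= S -> exists B : R, forall T n a, track_cut T n a ->
  B < `|n%:~R + 2^-1| -> a 1%g < 0 -> tail_pos phi a ->
  exists2 t, S <= t & T (phi t).
Proof.
move=> S0; have [B hB] := ray_bounded phi S0.
have [B' [C [cC C1 C0 CB]]] := bounded_connection tf (Vertex 1%g) (phi 0).
exists (Num.max B B') => T n a cT; rewrite gt_max => /andP[nB nB'] a1 [S' S0' hS'].
have neg0 : extend a (phi 0) < 0.
  apply: track_cut_neg cT cC _ C1 C0 a1 => z /CB zB e; move: zB; rewrite e.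
  by move=> h; have := le_lt_trans h nB'; rewrite ltxx.
have neg : extend a (phi S) < 0.
  apply: track_cut_neg cT (@ray_connected phi _ S (lexx 0)) _ _ _ neg0.
  - move=> _ [t + <-] e; rewrite /= in_itv /= => /hB; rewrite e => h.
    by have := le_lt_trans h nB; rewrite ltxx.
  - by exists 0 => //=; rewrite in_itv /= lexx.
  - by exists S => //=; rewrite in_itv /= S0 lexx.
have pos := hS' (Num.max S S').
rewrite le_max lexx orbT in pos; have {}pos := pos isT.
have SM : S <= Num.max S S' by rewrite le_max lexx.
have [_ [t + <-] ez] : exists2 z : K, (phi @` `[S, Num.max S S']) z & extend a z = 0.
  apply: (connected_between (@ray_connected phi _ _ S0) (x := phi S) (y := phi (Num.max S S'))).
  - by exists S => //=; rewrite in_itv /= lexx.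
  - by exists (Num.max S S') => //=; rewrite in_itv /= lexx SM.
  - by rewrite !ltW.
rewrite /= in_itv /= => /andP[St _]; exists t => //.
by have [_ _] := cT; apply.
Qed.

(** The levels [e * (k + 1/2)], so that rays of both signs are treated alike. *)
Definition level e k : int := if e == 1 then k%:Z else - k%:Z - 1.

Lemma levelE e k : is_sign e -> (level e k)%:~R + 2^-1 = e * (k%:R + 2^-1) :> R.
Proof.
rewrite /level => -[->|->]; first by rewrite eqxx mul1r.
rewrite ifF; last by apply/negbTE; rewrite lt_eqF//; lra.
by rewrite rmorphB rmorphN /= -[k%:Z%:~R]/(k%:R : R); lra.
Qed.

Lemma level_norm e k : is_sign e -> `|(level e k)%:~R + 2^-1 : R| = k%:R + 2^-1.
Proof.
move=> se; rewrite levelE// normrM.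
have -> : `|e| = 1 by case: se => ->; rewrite ?normrN normr1.
by rewrite mul1r ger0_norm// addr_ge0// invr_ge0.
Qed.

(** The tail lies beyond the level, so a track of this level separates [1] from
    a vertex next to the tail, and the tail does not meet it. *)
Lemma ray_cut phi e k : is_sign e -> escapes phi e ->
  exists T a, [/\ track_cut T (level e k) a, a 1%g < 0 & tail_pos phi a].
Proof.
move=> se ephi; have [S S0 hS] := ephi (k%:R + 2^-1).
have [v vS hv] := carrier_ge (fun g => e * f g) (phi S).
rewrite extendZ in hv.
(* The vertex [1] lies on the opposite side of the level from the tail, as [|f 1| <= d < 1/4]. *)
have f1 : `|f 1%g| <= d by have := tame_defect tf 1%g 1%g; rewrite mulg1 addrK.
have dd := tame_d_itv tf; have hS0 := hS _ (lexx S).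
have k0 : 0 <= k%:R :> R by [].
have [T [a [tT Tn a0 a1 av]]] : exists T (a : G -> R), [/\ tracks f T,
    (forall x, T x -> fx x = (level e k)%:~R + 2^-1),
    (forall x, extend a x = 0 -> T x), a 1%g < 0 & 0 < a v].
  apply: (separating_track tf); rewrite levelE//; rewrite ler_norml in f1.
  by move: hv hS0; case: se => ->; rewrite ?mul1r ?mulN1r => hv hS0; [left|right]; lra.
have cT : track_cut T (level e k) a by split.
exists T, a; split=> //; exists S => // t St.
have [s0 _] := tame_climb tf; have [c cS] := cell_cover s0 (phi S).
have [C [cC _ CS Cv hC]] := cell_hull cS (cell_vertex R (cell_carrier cS vS)).
have lev z : k%:R + 2^-1 < e * fx z -> fx z <> (level e k)%:~R + 2^-1.
  move=> h e'; move: h; rewrite e' levelE// mulrA.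
  have -> : e * e = 1 by case: se => ->; ring.
  by rewrite mul1r ltxx.
have pS : 0 < extend a (phi S).
  apply: (track_cut_pos cT cC _ Cv CS) => // z Cz; apply: lev.
  have := hC (fun g => - e * f g) (- (e * fx (phi S))) z Cz.
  rewrite !extendZ /= !mulNr lexx lerN2 hv => /(_ isT isT); rewrite lerN2.
  exact: lt_le_trans.
apply: (track_cut_pos cT (@ray_connected phi _ t S0) _ _ _ pS).
- by move=> _ [u + <-]; rewrite /= in_itv /= => /andP[Su _]; exact/lev/hS.
- by exists S => //=; rewrite in_itv /= lexx.
- by exists t => //=; rewrite in_itv /= lexx St.
Qed.

(** The vertices [(1, T_k)] whose boundary point is the image of the ray. *)
Definition crossing_seq phi e (X : nat -> V) := forall k, exists T (tT : tracks f T) a,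
  [/\ X k = track_vertex tT, track_cut T (level e k) a, a 1%g < 0 & tail_pos phi a].

Lemma crossing_seq_ex phi e : is_sign e -> escapes phi e -> exists X, crossing_seq phi e X.
Proof.
move=> se ephi; suff /choice[X hX] : forall k, exists v, exists T (tT : tracks f T) a,
  [/\ v = track_vertex tT, track_cut T (level e k) a, a 1%g < 0 & tail_pos phi a] by exists X.
move=> k; have [T [a [cT a1 pa]]] := ray_cut k se ephi.
by have [tT _ _] := cT; exists (track_vertex tT), T, tT, a.
Qed.

Lemma nat_gt (B : R) : exists N : nat, forall k, (N <= k)%N -> B < k%:R.
Proof.
exists (Num.trunc B).+1 => k Nk.
by apply: lt_le_trans (truncnS_gt B) _; rewrite ler_nat.
Qed.

(** For large [k] the track [X k] contains a late point of the ray, and it is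
    disjoint from [T]. *)
Lemma crossing_tail phi e X T n a : is_sign e -> crossing_seq phi e X -> track_cut T n a ->
  tail_pos phi a -> exists N : nat, forall k, (N <= k)%N ->
    forall p, vertex_set (X k) p -> 0 < extend a p.
Proof.
move=> se cX cT [S S0 hS]; have [B hB] := ray_meets phi S0.
have [N hN] := nat_gt (Num.max B `|n%:~R + 2^-1|).
exists N => k /hN; rewrite gt_max => /andP[kB kn].
have [T' [tT' [a' [-> cT' a1' pa']]]] := cX k; rewrite vertex_set_track_vertex => p T'p.
have [t St T't] : exists2 t, S <= t & T' (phi t).
  apply: hB cT' _ a1' pa'; rewrite level_norm//; lra.
have [_ [cnT' _ _ _]] := trackP tT'.
have [_ Tn' _] := cT'.
apply: (track_cut_pos cT cnT' _ T't T'p); last exact: hS.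
move=> z /Tn' -> e'; move: kn; rewrite -e' level_norm//; lra.
Qed.

(** No track separates the tails. Equivalence of rays amounts to this relation,
    and equality of boundary points implies it. *)
Definition same_tails phi psi := forall T n a, track_cut T n a -> tail_pos phi a -> tail_pos psi a.

Lemma same_tails_sym phi psi e : is_sign e -> escapes phi e ->
  same_tails phi psi -> same_tails psi phi.
Proof.
move=> se ephi pp T n a cT pa; have [//|na] := tail_side se ephi cT.
by have := tail_pos_contra pa (pp _ _ _ (track_cutN cT) na).
Qed.

Lemma same_tails_trans phi psi chi :
  same_tails phi psi -> same_tails psi chi -> same_tails phi chi.
Proof. by move=> h1 h2 T n a cT /(h1 _ _ _ cT)/(h2 _ _ _ cT). Qed.

Definition close_at e phi psi (C : R) := forall D, C < e * D -> exists delta : R -> K,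
      [/\ {within `[0, 1], continuous delta},
          forall t, 0 <= t <= 1 -> @cayley_graph R G P (delta t),
          ray_image phi (delta 0),
          ray_image psi (delta 1)
        & forall t, 0 <= t <= 1 -> `|fx (delta t) - D| <= C].

(** A path at a height far beyond the level of [T] and beyond the initial
    segments of both rays joins the two tails without meeting [T]. *)
Lemma close_same_tails e phi psi (C : R) : is_sign e -> escapes phi e -> escapes psi e ->
  close_at e phi psi C -> same_tails phi psi.
Proof.
move=> se ephi epsi cl T n a cT [S1 S10 h1].
have [//|[S2 S20 h2]] := tail_side se epsi cT.
exfalso; have [B1 hB1] := ray_bounded phi S10; have [B2 hB2] := ray_bounded psi S20.
have ee : e * e = 1 by case: se => ->; ring.
(* A height that exceeds every bound involved by more than [C]. *)
pose M := C + `|C| + `|B1| + `|B2| + `|n%:~R + 2^-1| + 1.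
have [] := cl (e * M).
  rewrite mulrA ee mul1r /M.
  have := normr_ge0 C; have := normr_ge0 B1; have := normr_ge0 B2.
  by have := normr_ge0 (n%:~R + 2^-1 : R); lra.
move=> delta [cd _ [t1 + e1] [t2 + e2] hD]; rewrite /= !in_itv /= !andbT => t10 t20.
have far t : 0 <= t <= 1 -> `|B1| + `|B2| + `|n%:~R + 2^-1| < `|fx (delta t)|.
  move=> /hD; rewrite ler_norml => /andP[l1 l2].
  have : M - C <= `|fx (delta t)|.
    case: se l1 l2 => ->; rewrite ?mul1r ?mulN1r => l1 l2.
      by apply: le_trans (ler_norm _); lra.
    by rewrite -normrN; apply: le_trans (ler_norm _); lra.
  by rewrite /M; have := normr_ge0 C; lra.
have I0 : 0 <= (0:R) <= 1 by rewrite lexx ler01.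
have I1 : 0 <= (1:R) <= 1 by rewrite lexx ler01.
have p0 : 0 < extend a (delta 0).
  rewrite -e1; apply: h1; rewrite leNgt; apply/negP => /ltW lt.
  have := hB1 t1; rewrite t10 lt e1 => /(_ isT); have := far _ I0.
  have := ler_norm B1; have := normr_ge0 B2; have := normr_ge0 (n%:~R + 2^-1 : R); lra.
have p1 : extend a (delta 1) < 0.
  rewrite -oppr_gt0 -extendN -e2; apply: h2; rewrite leNgt; apply/negP => /ltW lt.
  have := hB2 t2; rewrite t20 lt e2 => /(_ isT); have := far _ I1.
  have := ler_norm B2; have := normr_ge0 B1; have := normr_ge0 (n%:~R + 2^-1 : R); lra.
have : 0 < extend a (delta 1).
  apply: (track_cut_pos cT (C := delta @` `[0, 1]) _ _ _ _ p0).
  - by apply: connected_continuous_connected => //; exact: segment_connected.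
  - move=> _ [t + <-] e'; rewrite /= in_itv /= => /far; rewrite e'.
    have := normr_ge0 B2; have := normr_ge0 B1; lra.
  - by exists 0 => //=; rewrite in_itv.
  - by exists 1 => //=; rewrite in_itv.
by rewrite ltNge ltW.
Qed.

(** For rays of opposite signs, a track of high level separating [1] from the
    tail of [phi] would have to be crossed by [psi]. *)
Lemma same_tails_sign e e' phi psi : is_sign e -> is_sign e' -> escapes phi e -> escapes psi e' ->
  same_tails phi psi -> e = e'.
Proof.
move=> se se' ephi epsi pp; have [S S0 hS] := epsi 0; have [B hB] := ray_meets psi S0.
have [N hN] := nat_gt B.
have [T [a [cT a1 /(pp _ _ _ cT) pa]]] := ray_cut N se ephi.
have [|t St Tt] := hB _ _ _ cT _ a1 pa.
  by rewrite level_norm//; have := hN N (leqnn N); lra.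
have [_ Tn _] := cT; have := hS _ St; rewrite (Tn _ Tt) levelE// mulrA.
have N0 : 0 <= N%:R :> R by [].
by case: se se' => -> [] -> //; rewrite ?mulN1r ?mul1r ?mulr1; lra.
Qed.

(** A track of level close to [D] that separates [1] from the tail of [phi] also
    separates it from the tail of [psi]; both rays cross it. *)
Lemma same_tails_close e phi psi : is_sign e -> escapes phi e -> escapes psi e ->
  same_tails phi psi -> exists2 C, 0 < C & close_at e phi psi C.
Proof.
move=> se ephi epsi pp.
have [B1 hB1] := ray_meets phi (lexx 0); have [B2 hB2] := ray_meets psi (lexx 0).
have ee : e * e = 1 by case: se => ->; ring.
exists (`|B1| + `|B2| + 1) => [|D CD].
  by have := normr_ge0 B1; have := normr_ge0 B2; lra.
have D0 : 0 <= e * D by have := normr_ge0 B1; have := normr_ge0 B2; lra.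
pose k := Num.trunc (e * D).
have /andP[k1 k2] := truncn_itv D0; rewrite -/k -natr1 in k1 k2.
have [T [a [cT a1 pa]]] := ray_cut k se ephi.
have [tT Tn _] := cT.
have [|t1 t10 T1] := hB1 _ _ _ cT _ a1 pa.
  by rewrite level_norm//; have := ler_norm B1; have := normr_ge0 B2; lra.
have [|t2 t20 T2] := hB2 _ _ _ cT _ a1 (pp _ _ _ cT pa).
  by rewrite level_norm//; have := ler_norm B2; have := normr_ge0 B1; lra.
have [p [cp p0 p1 pb]] := track_graph_path tf tT Tn T1 T2 (ray_graph phi t10) (ray_graph psi t20).
exists p; split=> //.
- by move=> t /pb[].
- by rewrite p0; exists t1 => //=; rewrite in_itv /= t10.
- by rewrite p1; exists t2 => //=; rewrite in_itv /= t20.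
- move=> t /pb[_]; rewrite levelE// => h.
  have h2 : `|e * (k%:R + 2^-1) - D| <= 1 / 2.
    have -> : e * (k%:R + 2^-1) - D = e * (k%:R + 2^-1 - e * D) by rewrite mulrBr mulrA ee mul1r.
    rewrite normrM (_ : `|e| = 1) ?mul1r ?ler_norml; first by lra.
    by case: se => ->; rewrite ?normrN normr1.
  have -> : fx (p t) - D = (fx (p t) - e * (k%:R + 2^-1)) + (e * (k%:R + 2^-1) - D) by ring.
  apply: le_trans (ler_normD _ _) _.
  have := normr_ge0 B1; have := normr_ge0 B2; lra.
Qed.

End rays.
(** * Gromov products of crossing sequences *)

Section boundary.
Variables (R : realType) (G : groupType) (P : tri_presentation G).
Notation K := (cover_complex R P).
Variables (f : G -> R) (d : R).
Hypothesis tf : tame P f d.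
Notation V := (X_vertex P f).
Notation adj := (@X_adj R G P f).
Notation dist := (@X_dist R G P f).
Notation D := (gdist (X_connected tf)).
Notation vpt := (vertex_point R adj).
Notation track_cut := (track_cut f).

Lemma product_divergesP (X : Type) (dX : X -> X -> R) (m : X) (x y : nat -> X) :
  product_diverges dX m x y <-> forall B : R, exists N : nat, forall i j : nat,
    (N <= i)%N -> (N <= j)%N -> B <= gromov_product dX m (x i) (y j).
Proof.
rewrite /product_diverges; split=> [/cvgryPge h B|h].
  have [[U W] /= [[N1 _ hN1] [N2 _ hN2]] UW] := h B.
  exists (maxn N1 N2) => i j; rewrite !geq_max => /andP[i1 i2] /andP[j1 j2].
  by apply: (UW (i, j)); split => /=; [exact: hN1|exact: hN2].
apply/cvgryPge => B; have [N hN] := h B.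
exists ([set i | (N <= i)%N], [set j | (N <= j)%N]).
  by split; exists N.
by move=> [i j] [/= Ni Nj]; exact: hN.
Qed.

(** The walk realizing the distance passes within 2 of the track, and this
    detour is counted twice. *)
Lemma track_cut_gdist (T : set K) n (a : G -> R) (cT : track_cut T n a) (tT : tracks f T) v w :
  (forall p, vertex_set v p -> extend a p < 0) -> (forall p, vertex_set w p -> 0 < extend a p) ->
  (D v (track_vertex tT) + D (track_vertex tT) w <= D v w + 4)%N.
Proof.
move=> vn wp; have [x vx] := vertex_set_nonempty v; have [y wy] := vertex_set_nonempty w.
have [_ _ a0] := cT.
have [i [j [u [ij vu uw uT]]]] :=
  walk_bottleneck tf tT a0 (gdist_walk (X_connected tf) v w) vx wy (vn _ vx) (wp _ wy).
have h1 := gdist_le (X_connected tf) vu; have h2 := gdist_le (X_connected tf) uw.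
have h3 := gdist_le (X_connected tf) uT.
have h3' := h3; rewrite gdistC in h3'; last exact: X_adj_sym.
have t1 := gdist_triangle (X_connected tf) v u (track_vertex tT).
have t2 := gdist_triangle (X_connected tf) (track_vertex tT) u w.
lia.
Qed.

Lemma track_cut_vertex_set_neg (T : set K) n (a : G -> R) (v : V) q :
  track_cut T n a -> vertex_set v q ->
  extend a q < 0 -> `|extend f q| + 1 < `|n%:~R + 2^-1| ->
  forall p, vertex_set v p -> extend a p < 0.
Proof.
move=> cT vq aq nq p vp; apply: (track_cut_neg cT (@vertex_set_connected R G P f v) _ vq vp aq).
move=> z vz e; have := vertex_set_close tf vz vq; rewrite -e in nq.
have := ler_normD (extend f z - extend f q) (extend f q); rewrite subrK.
lra.
Qed.

Variable (m : X_space P f).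

Lemma gromov_product_near : exists v0, forall v w : V,
  `|gromov_product dist m (vpt v) (vpt w) -
     ((D v0 v)%:R + (D v0 w)%:R - (D v w)%:R) / 2| <= 1.
Proof.
have [v0 h] := path_dist_near (@X_adj_sym R G P f) (X_connected tf) m; exists v0 => v w.
rewrite /gromov_product /X_dist (path_dist_vertex R (@X_adj_sym R G P f) (X_connected tf)).
have := h v; have := h w; rewrite !ler_norml; lra.
Qed.

(** For [k] large the track [X k] separates the base point from [X i] and [X j]
    for all large [i] and [j], hence their product is at least the distance from
    the base point to [X k] up to a constant; this distance is large since [|f|]
    is large on the track. *)
Lemma crossing_seq_diverges phi e X : is_sign e -> crossing_seq (f := f) phi e X ->
  product_diverges dist m (vpt \o X) (vpt \o X).
Proof.
move=> se cX; have [v0 h0] := gromov_product_near; apply/product_divergesP => B.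
have [q vq] := vertex_set_nonempty v0.
have [B' [C [cC C1 Cq CB]]] := bounded_connection tf (Vertex 1%g) q.
(* Along walks [f] changes by at most 3 per step, so this level is far from the base vertex. *)
have [k hk] := nat_gt (`|B'| + `|extend f q| + 3 * (`|B| + 6) + 1).
have {}hk := hk _ (leqnn k).
have [B0 B'0 q0] : [/\ 0 <= `|B|, 0 <= `|B'| & 0 <= `|extend f q|] by [].
have [T [tT [a [Xk cT a1 pa]]]] := cX k.
have [N hN] := crossing_tail tf se cX cT pa.
have aq : extend a q < 0.
  apply: (track_cut_neg cT cC _ C1 Cq a1) => z /CB zB e'; move: zB.
  by rewrite e' level_norm//; have := ler_norm B'; lra.
have v0n : forall p, vertex_set v0 p -> extend a p < 0.
  by apply: (track_cut_vertex_set_neg cT vq aq); rewrite level_norm//; lra.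
have far : `|B| + 5 <= (D v0 (track_vertex tT))%:R.
  have [p Tp] := vertex_set_nonempty (track_vertex tT).
  have := walk_level tf (gdist_walk (X_connected tf) _ _) vq Tp.
  rewrite vertex_set_track_vertex in Tp; have [_ Tn _] := cT; rewrite (Tn _ Tp).
  have := ler_normB ((level e k)%:~R + 2^-1 - extend f q) (- extend f q).
  rewrite opprK subrK normrN level_norm// [`|_ - extend f q|]distrC.
  lra.
exists N => i j /hN ip /hN jp /=.
have hi := track_cut_gdist cT tT v0n ip; have hj := track_cut_gdist cT tT v0n jp.
have := gdist_triangle (X_connected tf) (X i) (track_vertex tT) (X j).
rewrite [D (X i) (track_vertex _)]gdistC; last exact: X_adj_sym.
have := h0 (X i) (X j); move: hi hj.
rewrite -!(ler_nat R) !natrD ler_norml => hi hj h t.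
have := ler_norm B; lra.
Qed.

(** A track [T] separating the tails would bound the products by the distance
    from the base point to [T] up to a constant. *)
Lemma diverges_same_tails phi psi e e' X Y : is_sign e -> is_sign e' ->
  escapes f psi e' ->
  crossing_seq (f := f) phi e X -> crossing_seq (f := f) psi e' Y ->
  product_diverges dist m (vpt \o X) (vpt \o Y) -> same_tails f phi psi.
Proof.
move=> se se' epsi cX cY /product_divergesP dXY T n a cT pa.
have [//|na] := tail_side se' epsi cT; exfalso.
have [v0 h0] := gromov_product_near.
have [N1 hX] := crossing_tail tf se cX cT pa.
have [N2 hY] := crossing_tail tf se' cY (track_cutN cT) na.
have [tT _ _] := cT.
have [N hN] := dXY ((D v0 (track_vertex tT))%:R + 4).
pose i := maxn N (maxn N1 N2).
have [iN [i1 i2]] : (N <= i)%N /\ (N1 <= i)%N /\ (N2 <= i)%N by rewrite /i; lia.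
have Yn p : vertex_set (Y i) p -> extend a p < 0.
  by move=> /(hY _ i2); rewrite extendN oppr_gt0.
have := track_cut_gdist cT tT Yn (hX _ i1).
rewrite [D (Y i) (X i)]gdistC ?[D (Y i) _]gdistC; try exact: X_adj_sym.
have := gdist_triangle (X_connected tf) v0 (track_vertex tT) (X i).
have := gdist_triangle (X_connected tf) v0 (track_vertex tT) (Y i).
have := h0 (X i) (Y i); have := hN i i iN iN => /=.
rewrite -!(ler_nat R) !natrD ler_norml; lra.
Qed.

End boundary.

(** * The scaled pseudocharacter *)

Section scaling.
Variables (R : realType) (G : groupType) (P : tri_presentation G).
Variables (f : G -> R) (c : R).
Hypotheses (f_pseudo : pseudocharacter f)
  (S_large : exists s : generators P, defect f < f (gen s))
  (c_gt0 : 0 < c) (eps_small : epsilon P (c \*o f) < 1 / 4)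
  (f_half : forall (g : G) (n : int), c * f g <> n%:~R + 2^-1).

Lemma scaled_tame : tame P (c \*o f) (defect (c \*o f)).
Proof.
have [_ ub] := f_pseudo.
have cabs g h : `|c * f g + c * f h - c * f (g * h)%g| = c * `|f g + f h - f (g * h)%g|.
  by rewrite -mulrDr -mulrBr normrM (gtr0_norm c_gt0).
have fle g h : `|f g + f h - f (g * h)%g| <= defect f.
  by apply: sup_upper_bound; [split=> //; exists `|f 1%g + f 1%g - f (1 * 1)%g|, (1%g, 1%g)|exists (g, h)].
have dle g h : `|c * f g + c * f h - c * f (g * h)%g| <= defect (c \*o f).
  apply: sup_upper_bound; last by exists (g, h).
  split; first by exists `|c * f 1%g + c * f 1%g - c * f (1 * 1)%g|, (1%g, 1%g).
  by exists (c * defect f) => _ [[g' h'] _ <-] /=; rewrite cabs ler_pM2l.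
split=> //.
- move=> s; apply: le_lt_trans eps_small; rewrite /epsilon lerD2r.
  apply: sup_upper_bound; last by exists s.
  split; first by exists `|c * f (gen s)|, s.
  exists (\sum_(s' : generators P) `|c * f (gen s')|) => _ [s' _ <-].
  by rewrite (bigD1 s')//= lerDl sumr_ge0.
- have [s sl] := S_large; exists s; apply: (@le_lt_trans _ _ (c * defect f)).
    apply: ge_sup; first by exists `|c * f 1%g + c * f 1%g - c * f (1 * 1)%g|, (1%g, 1%g).
    by move=> _ [[g h] _ <-] /=; rewrite cabs ler_pM2l.
  by rewrite /= ltr_pM2l.
Qed.

Lemma extend_scaled x : extend (c \*o f) x = c * @extend R G P f x.
Proof. exact: extendZ. Qed.

Lemma ray_sign_escapes (phi : ray R P) :
  ray_sign f phi = 1 \/ ray_sign f phi = -1 -> escapes (c \*o f) phi (ray_sign f phi).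
Proof.
rewrite /ray_sign; case: asboolP => [h _|_].
  move=> B; move/cvgryPgt : h => /(_ (B / c))[M [_ hM]].
  exists (Num.max 0 (M + 1)) => [|t]; first by rewrite le_max lexx.
  rewrite ge_max => /andP[_ Mt]; rewrite mul1r extend_scaled.
  by rewrite mulrC -ltr_pdivrMr//; apply: hM; lra.
case: asboolP => [h _|_ [|]]; [|lra|lra].
move=> B; move/cvgrNyPlt : h => /(_ (- (B / c)))[M [_ hM]].
exists (Num.max 0 (M + 1)) => [|t]; first by rewrite le_max lexx.
rewrite ge_max => /andP[_ Mt]; rewrite mulN1r extend_scaled.
rewrite -mulrN mulrC -ltr_pdivrMr// ltrNr; apply: hM; lra.
Qed.

Lemma ray_equiv_tails (phi psi : ray R P) :
  ray_sign f phi = 1 \/ ray_sign f phi = -1 -> ray_equiv f phi psi ->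
  ray_sign f phi = ray_sign f psi /\ same_tails (c \*o f) phi psi.
Proof.
move=> sphi [C C0 [e h]]; split=> //.
have ephi := ray_sign_escapes sphi.
have epsi : escapes (c \*o f) psi (ray_sign f phi).
  by rewrite e; apply: ray_sign_escapes; rewrite -e.
apply: (close_same_tails sphi ephi epsi (C := c * C)) => D CD.
have [|p [p1 p2 p3 p4 p5]] := h (D / c).
  by rewrite mulrA ltr_pdivlMr// mulrC.
exists p; split=> // t /p5 pt; rewrite extend_scaled.
have -> : c * extend f (p t) - D = c * (extend f (p t) - D / c).
  by rewrite mulrBr mulrCA divff ?mulr1// gt_eqF.
by rewrite normrM gtr0_norm// ler_pM2l.
Qed.

Lemma tails_ray_equiv (phi psi : ray R P) :
  ray_sign f phi = 1 \/ ray_sign f phi = -1 ->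
  ray_sign f psi = 1 \/ ray_sign f psi = -1 ->
  same_tails (c \*o f) phi psi -> ray_equiv f phi psi.
Proof.
move=> sphi spsi st; have ephi := ray_sign_escapes sphi; have epsi := ray_sign_escapes spsi.
have e := same_tails_sign scaled_tame sphi spsi ephi epsi st.
rewrite -e in epsi.
have [C C0 h] := same_tails_close scaled_tame sphi ephi epsi st.
exists (C / c); first by rewrite divr_gt0.
split=> // D CD; have [|p [p1 p2 p3 p4 p5]] := h (c * D).
  by rewrite mulrCA mulrC -ltr_pdivrMr.
exists p; split=> // t /p5; rewrite extend_scaled -mulrBr normrM gtr0_norm//.
by rewrite ler_pdivlMr// mulrC.
Qed.

End scaling.

Theorem lemma4p17 (R : realType) (G : groupType) (f : G -> R)
    (P : tri_presentation G) (c : R)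
    (f_pseudo : pseudocharacter f)
    (S_large : exists s : generators P, defect f < f (gen s))
    (c_gt0 : 0 < c)
    (eps_small : epsilon P (c \*o f) < 1 / 4)
    (f_half : forall (g : G) (n : int), c * f g <> n%:~R + 2^-1)
    (m : X_space P (c \*o f)) :
  exists F : set (ray R P) -> set (nat -> X_space P (c \*o f)),
    set_fun (relative_ends f) (gromov_boundary (@X_dist R G P (c \*o f)) m) F /\
    set_inj (relative_ends f) F.
Proof.
have tF := scaled_tame f_pseudo S_large c_gt0 eps_small f_half.
have escape := @ray_sign_escapes R G P f c c_gt0.
pose proper (phi : ray R P) := ray_sign f phi = 1 \/ ray_sign f phi = -1.
have [v0 _] := baryP m.
have /choice[X hX] (phi : ray R P) : exists X, proper phi ->
    crossing_seq (f := c \*o f) phi (ray_sign f phi) X.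
  have [pphi|np] := pselect (proper phi); last by exists (fun=> v0).
  by have [X ?] := crossing_seq_ex tF pphi (escape phi pphi); exists X.
pose x phi := vertex_point R (@X_adj R G P (c \*o f)) \o X phi.
(* The class [S] goes to the boundary point of a chosen representative. *)
pose F S := if pselect (relative_ends f S) is left rS
  then [set y | product_diverges (@X_dist R G P (c \*o f)) m y y /\
    product_diverges (@X_dist R G P (c \*o f)) m (x (sval (cid2 rS))) y] else set0.
have xx phi : proper phi -> product_diverges (@X_dist R G P (c \*o f)) m (x phi) (x phi).
  by move=> pphi; exact: (crossing_seq_diverges tF m pphi (hX _ pphi)).
exists F; split.
  move=> S rS; rewrite /F; case: pselect => // rS'; case: (cid2 _) => phi /= pphi _.
  by exists (x phi) => //; exact: xx.
move=> S S'; rewrite !inE /F; case: pselect => // rS _; case: pselect => // rS' _.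
case: (cid2 _) => phi /= pphi <-; case: (cid2 _) => psi /= ppsi <- FE.
have : [set y | product_diverges (@X_dist R G P (c \*o f)) m y y /\
    product_diverges (@X_dist R G P (c \*o f)) m (x phi) y] (x psi).
  by rewrite FE; split; exact: xx.
move=> [_ dxy].
have st := diverges_same_tails tF pphi ppsi (escape _ ppsi) (hX _ pphi) (hX _ ppsi) dxy.
have ts := same_tails_sym pphi (escape _ pphi) st.
apply/seteqP; split=> chi /= eq.
- have [e h] := ray_equiv_tails c_gt0 pphi eq.
  apply: (tails_ray_equiv f_pseudo S_large c_gt0 eps_small f_half ppsi).
    by rewrite -e.
  exact: same_tails_trans ts h.
- have [e h] := ray_equiv_tails c_gt0 ppsi eq.
  apply: (tails_ray_equiv f_pseudo S_large c_gt0 eps_small f_half pphi).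
    by rewrite -e.
  exact: same_tails_trans st h.
Qed.
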